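(* Let $m\ge1$ and $t\in\mathbb Z_{\ge0}$. (i) If $\mathbf{char}(q)=0$, then for $t\le n$, $$\dim_\Bbbk\Omega_q(m|n)^{(t)}=\dim_\Bbbk V(t\omega_1)=\sum_{0\le s\le t}\binom{m+t-s-1}{t-s}\binom ns,$$ and for $t>n$, $$\dim_\Bbbk\Omega_q(m|n)^{(t)}=\dim_\Bbbk V(t\omega_1)=\sum_{0\le s\le n}\binom{m+t-s-1}{t-s}\binom ns.$$ (ii) If $\mathbf{char}(q)=\ell$ $(>2)$, then for $t\le n$, $$\dim_\Bbbk\Omega_q(m|n,\mathbf 1)^{(t)}=\sum_{0\le s\le t}\binom ns\dim_\Bbbk\mathcal A_q^{(t-s)}(m;\mathbf 1),$$ and for $t>n$, $$\dim_\Bbbk\Omega_q(m|n,\mathbf 1)^{(t)}=\sum_{0\le s\le n}\binom ns\dim_\Bbbk\mathcal A_q^{(t-s)}(m;\mathbf 1),$$ where $\dim_\Bbbk\mathcal A_q^{(s)}(m;\mathbf 1)=\sum_{i=0}^{\lfloor s/\ell\rfloor}(-1)^i\binom mi\binom{m+s-i\ell-1}{m-1}$. Moreover, if $t=(i-1)(\ell-1)+t_i$ with $1\le i\le m$, $0\le t_i\le\ell-1$, this number equals $\dim_\Bbbk V((\ell-1-t_i)\omega_{i-1}+t_i\omega_i)$.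
   Context: $\Bbbk$ is an algebraically closed field of characteristic zero, $q\in\Bbbk^\times$, $q^2\ne1$; $m,n\ge 0$ are integers, $I_0=\{1,\dots,m\}$, $I_1=\{m+1,\dots,m+n\}$, $I=I_0\cup I_1$, $J=\{1,\dots,m+n-1\}$. $\mathbf{char}(q)$ is the least positive integer $\ell$ with $[\ell]=\frac{q^\ell-q^{-\ell}}{q-q^{-1}}=0$, and $0$ if none exists. $\Omega_q(m|n)$ (quantum Grassmann superalgebra) has $\Bbbk$-basis $x^{(\alpha)}\otimes x^\mu$, $\alpha\in\mathbb Z_{\ge0}^m$, $\mu\in\{0,1\}^n$; when $\mathbf{char}(q)=\ell\ge3$, $\Omega_q(m|n,\mathbf 1)$ is the span of those with all $\alpha_i\le\ell-1$. $\Omega_q^{(t)}$ is the span of the basis elements in $\Omega_q$ with $|\alpha|+|\mu|=t$, where $|\cdot|$ is the sum of entries. $\mathcal A_q^{(s)}(m;\mathbf 1)$ is the vector space with basis $x^{(\alpha)}$, $0\le\alpha_i\le\ell-1$, $\alpha_1+\dots+\alpha_m=s$ (degree $s$ part of the quantum restricted divided power algebra). $V(\lambda)$: put $q_i=q$ for $i\in I_0$, $q_i=q^{-1}$ for $i\in I_1$, $p(i)=\delta_{im}$. $U_q(\mathfrak{gl}(m|n))$ is generated by $E_j,F_j$ $(j\in J)$, $K_i^{\pm1}$ $(i\in I)$, where $\mathcal K_i=K_iK_{i+1}^{-1}$, with relations (whenever all indices are in range): $K_iK_j=K_jK_i$, $K_iK_i^{-1}=1=K_i^{-1}K_i$; $K_iE_j=q_i^{\delta_{ij}-\delta_{i,j+1}}E_jK_i$,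 $K_iF_j=q_i^{-\delta_{ij}+\delta_{i,j+1}}F_jK_i$; $E_iF_j-(-1)^{p(i)p(j)}F_jE_i=\delta_{ij}\frac{\mathcal K_i-\mathcal K_i^{-1}}{q_i-q_i^{-1}}$; $E_iE_j=E_jE_i$, $F_iF_j=F_jF_i$ for $|i-j|>1$; $E_i^2E_j-(q+q^{-1})E_iE_jE_i+E_jE_i^2=0$ for $|i-j|=1$, $i\ne m$, and likewise for $F$; $E_m^2=F_m^2=0$; $E_{m-1}E_mE_{m+1}E_m+E_mE_{m-1}E_mE_{m+1}+E_{m+1}E_mE_{m-1}E_m+E_mE_{m+1}E_mE_{m-1}-(q+q^{-1})E_mE_{m-1}E_{m+1}E_m=0$, and likewise for $F$. The bosonization $\mathcal U_q=\mathcal U_q(\mathfrak{gl}(m|n))$ is generated by $U_q(\mathfrak{gl}(m|n))$ and $\sigma$ with $\sigma^2=1$, $\sigma E_j\sigma=(-1)^{p(j)}E_j$, $\sigma F_j\sigma=(-1)^{p(j)}F_j$, $\sigma K_i\sigma=K_i$; the version $\mathcal U_q(\mathfrak{sl}(m|n))$ has $\mathcal K_j^{\pm1}$ $(j\in J)$ in place of the $K_i^{\pm1}$. When $\mathbf{char}(q)=\ell>2$, $u_q=\mathcal U_q/(E_i^\ell,F_i^\ell\ (m\ne i\in J),\ E_m^2,\ F_m^2,\ K_i^{2\ell}-1)$ (for $\mathfrak{sl}$, $\mathcal K_i^{2\ell}-1$). Let $\omega_i=\epsilon_1+\cdots+\epsilon_i$, $\omega_0=0$, and $(\epsilon_i,\epsilon_j)=\delta_{ij}$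 for $i\in I_0$, $-\delta_{ij}$ for $i\in I_1$. $V(\lambda)$ denotes the simple module over $\mathcal U_q$ (in (i)), respectively over $u_q$ (in (ii)), generated by a highest weight vector of weight $\lambda$, i.e. a nonzero $v$ with $E_jv=0$ $(j\in J)$ and $K_iv=q^{(\lambda,\epsilon_i)}v$ $(i\in I)$ (for $\mathfrak{sl}$: $\mathcal K_jv=q^{(\lambda,\epsilon_j-\epsilon_{j+1})}v$).
   Formalization: In (ii), V(λ) is additionally required to have all sufficiently long monomials in the F_j kill its highest weight vector, since u_q as presented (only simple root vectors truncated) has several simple modules of the same highest weight when m≥3 or n≥3. *)

(* Defs.v *)
From mathcomp Require Import all_boot all_order all_algebra.
From mathcomp Require Import monalg.

Set Implicit Arguments.
Unset Strict Implicit.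
Unset Printing Implicit Defensive.

Import GRing.Theory.

Local Open Scope ring_scope.

Definition lspan (k : fieldType) (V : lmodType k) (S : V -> Prop) : V -> Prop :=
  fun v => exists (r : nat) (c : 'I_r -> k) (w : 'I_r -> V),
    (forall i, S (w i)) /\ v = \sum_i c i *: w i.

(* The subspace W of the (possibly infinite-dimensional) space V has finite
   dimension d. *)
Definition has_dim (k : fieldType) (V : lmodType k) (W : V -> Prop) (d : nat) :
    Prop :=
  exists b : 'I_d -> V,
    [/\ forall i, W (b i),
        forall c : 'I_d -> k, \sum_i c i *: b i = 0 -> forall i, c i = 0
      & forall v, W v -> exists c : 'I_d -> k, v = \sum_i c i *: b i].

Definition qint (k : fieldType) (q : k) (l : nat) : k :=
  (q ^+ l - q ^- l) / (q - q^-1).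

Definition qchar_is (k : fieldType) (q : k) (l : nat) : Prop :=
  if l is 0 then forall j, (0 < j)%N -> qint q j != 0
  else qint q l = 0 /\ forall j, (0 < j < l)%N -> qint q j != 0.

(* {malg k[T]} is the free k-module on T, with basis << b >>, b : T. *)

Notation gr_index m n := ({ffun 'I_m -> nat} * {ffun 'I_n -> bool})%type.

Definition gr_degree m n (b : gr_index m n) : nat :=
  (\sum_i b.1 i + \sum_i b.2 i)%N.

Definition Omega (k : fieldType) (m n : nat) := {malg k[gr_index m n]}.

Definition Omega_deg (k : fieldType) (m n t : nat) : Omega k m n -> Prop :=
  lspan (fun w => exists b : gr_index m n, gr_degree b = t /\ w = << b >>).

Definition Omega1_deg (k : fieldType) (l m n t : nat) : Omega k m n -> Prop :=
  lspan (fun w => exists b : gr_index m n,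
    [/\ forall i, (b.1 i <= l.-1)%N, gr_degree b = t & w = << b >>]).

Definition DivPow (k : fieldType) (m : nat) := {malg k[{ffun 'I_m -> nat}]}.

Definition A1_deg (k : fieldType) (l m s : nat) : DivPow k m -> Prop :=
  lspan (fun w => exists a : {ffun 'I_m -> nat},
    [/\ forall i, (a i <= l.-1)%N, (\sum_i a i)%N = s & w = << a >>]).

(* An integral weight is the function sending i, 1 <= i <= m + n, to its
   coefficient on epsilon_i; values at other arguments are never used. *)
Definition weight := nat -> int.

Definition eps (i : nat) : weight := fun j => (i == j)%:Z.

Definition omega (i : nat) : weight := fun j => (0 < j <= i)%:Z.

Definition wadd (x y : weight) : weight := fun j => x j + y j.
Definition wscale (a : int) (x : weight) : weight := fun j => a * x j.

Definition wform (m n : nat) (x y : weight) : int :=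
  \sum_(1 <= i < (m + n).+1) (if (i <= m)%N then x i * y i else - (x i * y i)).

Variant version := GL | SL.

(* A module over an algebra given by generators and relations is a vector space
   with operators for the generators satisfying the relations.  Generators carry
   the 1-based indices of their mathematical names; operators whose index is out
   of range are unconstrained and never used.  actK i is K_i for GL, and is
   K_i K_{i+1}^{-1} for SL, actKV i is its inverse. *)
Record action (k : fieldType) (V : lmodType k) := Action {
  actE : nat -> {linear V -> V};
  actF : nat -> {linear V -> V};
  actK : nat -> {linear V -> V};
  actKV : nat -> {linear V -> V};
  actS : {linear V -> V}
}.

Section QuantumSuper.

Variables (X : version) (k : fieldType) (q : k) (m n : nat).

Definition inJ (j : nat) : bool := (0 < j < m + n)%N.

Definition inTorus (i : nat) : bool :=
  if X is GL then (0 < i <= m + n)%N else inJ i.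

Definition qi (i : nat) : k := if (i <= m)%N then q else q^-1.

Definition parity (j : nat) : nat := (j == m).

(* K_i E_j = Kchar i j E_j K_i in the GL version. *)
Definition Kchar (i j : nat) : k := qi i ^ ((i == j)%:Z - (i == j.+1)%:Z).

(* The SL coefficient is the one for K_i K_{i+1}^{-1}. *)
Definition torus_char (i j : nat) : k :=
  if X is GL then Kchar i j else Kchar i j / Kchar i.+1 j.

Section Action.

Variables (V : lmodType k) (A : action V).

Local Notation E := (actE A).
Local Notation F := (actF A).
Local Notation K := (actK A).
Local Notation KV := (actKV A).
Local Notation S := (actS A).

Definition calK (i : nat) (v : V) : V :=
  if X is GL then K i (KV i.+1 v) else K i v.
Definition calKV (i : nat) (v : V) : V :=
  if X is GL then KV i (K i.+1 v) else KV i v.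

Definition torus_relations : Prop :=
  [/\ forall i j v, inTorus i -> inTorus j -> K i (K j v) = K j (K i v),
      forall i v, inTorus i -> K i (KV i v) = v /\ KV i (K i v) = v,
      forall i j v, inTorus i -> inJ j ->
        K i (E j v) = torus_char i j *: E j (K i v)
    & forall i j v, inTorus i -> inJ j ->
        K i (F j v) = (torus_char i j)^-1 *: F j (K i v)].

Definition EF_relation : Prop :=
  forall i j v, inJ i -> inJ j ->
    E i (F j v) - (-1) ^+ (parity i * parity j) *: F j (E i v)
    = (i == j)%:R *: ((qi i - (qi i)^-1)^-1 *: (calK i v - calKV i v)).

(* The relations imposed on the E's alone, and likewise on the F's alone. *)
Definition Serre_relations (G : nat -> {linear V -> V}) : Prop :=
  [/\ forall i j v, inJ i -> inJ j -> ((i.+1 < j) || (j.+1 < i))%N ->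
        G i (G j v) = G j (G i v),
      forall i j v, inJ i -> inJ j -> (i == j.+1) || (j == i.+1) -> i != m ->
        G i (G i (G j v)) - (q + q^-1) *: G i (G j (G i v)) + G j (G i (G i v))
        = 0,
      forall v, inJ m -> G m (G m v) = 0
    & forall v, inJ m.-1 -> inJ m -> inJ m.+1 ->
        G m.-1 (G m (G m.+1 (G m v))) + G m (G m.-1 (G m (G m.+1 v)))
        + G m.+1 (G m (G m.-1 (G m v))) + G m (G m.+1 (G m (G m.-1 v)))
        - (q + q^-1) *: G m (G m.-1 (G m.+1 (G m v))) = 0].

Definition sigma_relations : Prop :=
  [/\ forall v, S (S v) = v,
      forall j v, inJ j -> S (E j (S v)) = (-1) ^+ parity j *: E j v,
      forall j v, inJ j -> S (F j (S v)) = (-1) ^+ parity j *: F j v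
    & forall i v, inTorus i -> S (K i (S v)) = K i v].

Definition is_module : Prop :=
  [/\ torus_relations, EF_relation, Serre_relations E, Serre_relations F
    & sigma_relations].

(* The further relations defining the quotient u_q (E_m^2 = F_m^2 = 0 already
   being among the relations above). *)
Definition restricted_relations (l : nat) : Prop :=
  [/\ forall j v, inJ j -> j != m -> iter l (E j) v = 0,
      forall j v, inJ j -> j != m -> iter l (F j) v = 0
    & forall i v, inTorus i -> iter (2 * l) (K i) v = v].

Definition is_submodule (W : V -> Prop) : Prop :=
  [/\ W 0 /\ (forall a u v, W u -> W v -> W (a *: u + v)),
      forall j v, inJ j -> W v -> W (E j v) /\ W (F j v),
      forall i v, inTorus i -> W v -> W (K i v) /\ W (KV i v)
    & forall v, W v -> W (S v)].

Definition is_simple : Prop :=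
  (exists v : V, v != 0) /\
  forall W : V -> Prop, is_submodule W ->
    (forall v, W v -> v = 0) \/ (forall v, W v).

Definition generated_by (v : V) : Prop :=
  forall W : V -> Prop, is_submodule W -> W v -> forall u, W u.

Definition torus_weight (lam : weight) (i : nat) : int :=
  if X is GL then wform m n lam (eps i)
  else wform m n lam (wadd (eps i) (wscale (-1) (eps i.+1))).

Definition highest_weight_vector (lam : weight) (v : V) : Prop :=
  [/\ v != 0,
      forall j, inJ j -> E j v = 0
    & forall i, inTorus i -> K i v = q ^ torus_weight lam i *: v].

(* All long enough monomials in the F_j annihilate v. *)
Definition F_nilpotent (v : V) : Prop :=
  exists N : nat, forall s : seq nat, all inJ s -> (N <= size s)%N ->
    foldr (fun j w => F j w) v s = 0.

Definition is_Vlam (lam : weight) : Prop :=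
  [/\ is_module, is_simple
    & exists v, highest_weight_vector lam v /\ generated_by v].

(* V(lam) over u_q.  The relations presenting u_q kill the l-th powers of the
   simple even root vectors only.  The l-th powers of the other even root vectors
   survive when m >= 3 or n >= 3 and can act on a simple highest weight module by
   nonzero scalars, so the highest weight alone does not determine such a module.
   V(lam) is the one, unique up to isomorphism and parity shift, on whose highest
   weight vector the F_j are jointly nilpotent, as they are on every module over
   the finite-dimensional small quantum group. *)
Definition is_Vlam_restricted (l : nat) (lam : weight) : Prop :=
  [/\ is_module, restricted_relations l, is_simple
    & exists v, [/\ highest_weight_vector lam v, generated_by v
                  & F_nilpotent v]].

End Action.

(* dim V(lam) = d: such a module exists, and every such module has dimension d.
   (Two of them differ at most by the sign of sigma.) *)
Definition dim_Vlam_is (lam : weight) (d : nat) : Prop :=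
  (exists (V : lmodType k) (A : action V), is_Vlam A lam) /\
  forall (V : lmodType k) (A : action V), is_Vlam A lam ->
    has_dim (fun _ : V => True) d.

Definition dim_Vlam_restricted_is (l : nat) (lam : weight) (d : nat) : Prop :=
  (exists (V : lmodType k) (A : action V), is_Vlam_restricted A l lam) /\
  forall (V : lmodType k) (A : action V), is_Vlam_restricted A l lam ->
    has_dim (fun _ : V => True) d.

End QuantumSuper.

(* Main.v *)
Require Import Defs.
From Stdlib Require Classical_Prop.
From HB Require Import structures.
From mathcomp Require Import all_boot all_order all_algebra.
From mathcomp Require Import monalg.
From mathcomp Require Import ring lra zify.

(** The degree t part of the quantum Grassmann superalgebra is a space of
    occupation numbers: its basis vectors are the sequences (a_1, ..., a_(m+n)) of
    sum t, where the last n entries are at most 1 and, at a root of unity, the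
    first m are less than l.  The operator E_j moves one unit from position j + 1
    to position j, with coefficient the quantum integer of the new value at j, and
    F_j moves it back.  The theorem says that this module is V(lambda), and its
    dimension is found by counting sequences.

    It is a module because products of such operators can be evaluated by following
    the occupation numbers (run_at): the coefficient vanishes as soon as a value
    would become negative or return from beyond its bound, [l] = 0 being responsible
    for the latter.  Each defining relation is then an identity between quantum
    integers, mostly [a+1] - [2][a] + [a-1] = 0.

    It is simple because there is only one sequence in which no unit can be moved
    to a smaller position: the E_j lead from any nonzero vector to this sequence
    (submodule_top), the F_j lead from it to all others (submodule_full).  Its
    weight is lambda.

    It remains to see that any other simple module V of highest weight lambda has
    the same dimension (highest_weight_unique).  The submodule of the direct sum of
    two such modules that is generated by the pair (v, v') of highest weight vectors
    is the graph of an isomorphism unless it contains (v, 0) or (0, v').  In that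
    case some combination of nonempty words in the F_j, all of the weight of the
    empty word, has one of the two vectors as a fixed point, and the point is to
    show that such a combination acts nilpotently.  At a root of unity this is the
    nilpotency of the F_j that belongs to the description of V(lambda).  For q not a
    root of unity it is not automatic either, because over sl(m|m) the weights of
    nonempty words can be trivial.  However such a word contains the odd generator
    F_m (generic_trivial_word), and words with many letters F_m act as zero in every
    module (odd_words_nilpotent): there are only mn odd root vectors, each of them
    squares to zero, and each commutes with the generators up to scalars and earlier
    root vectors.

    The numbers of sequences are coefficients of the polynomial
    (1 + X + ... + X^(l-1))^m (1 + X)^n, where l is replaced by a large number in
    the generic case (occupation_count, coef_geom_pow, coef_truncated). *)

Set Implicit Arguments.
Unset Strict Implicit.
Unset Printing Implicit Defensive.

Import Order.TTheory GRing.Theory Num.Theory.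

Local Open Scope ring_scope.

(** * Equalities between linear combinations *)

Section LinearNormalisation.

Variables (k : fieldType) (V : lmodType k).

(** Linear combinations of vectors named by their index in a list, so that an
    equality of two of them becomes a list of scalar equalities for ring or
    field. *)
Inductive lexp :=
  LZero | LAtom of nat | LAdd of lexp & lexp | LOpp of lexp
| LScale of k & lexp.

Fixpoint leval (env : seq V) (e : lexp) : V :=
  match e with
  | LZero => 0
  | LAtom i => nth 0 env i
  | LAdd a b => leval env a + leval env b
  | LOpp a => - leval env a
  | LScale c a => c *: leval env a
  end.

Fixpoint lcoef (e : lexp) (i : nat) : k :=
  match e with
  | LZero => 0
  | LAtom j => if Nat.eqb j i then 1 else 0
  | LAdd a b => lcoef a i + lcoef b i
  | LOpp a => - lcoef a i
  | LScale c a => c * lcoef a i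
  end.

Fixpoint all_below (P : nat -> Prop) (n : nat) : Prop :=
  if n is p.+1 then all_below P p /\ P p else True.

Lemma leval_lcoef env e :
  leval env e = \sum_(i < size env) lcoef e i *: nth 0 env i.
Proof.
elim: e => [|j|a IHa b IHb|a IHa|c a IHa] /=.
- by rewrite big1 // => i _; rewrite scale0r.
- case: (ltnP j (size env)) => [ltj|gej].
    rewrite (bigD1 (Ordinal ltj)) //= PeanoNat.Nat.eqb_refl scale1r.
    rewrite big1 ?addr0 // => i /eqP neq; case: PeanoNat.Nat.eqb_spec => [E|_].
      by case: neq; apply: val_inj.
    by rewrite scale0r.
  rewrite nth_default // big1 // => i _.
  case: PeanoNat.Nat.eqb_spec => [E|_]; last by rewrite scale0r.
  by have := ltn_ord i; rewrite -E ltnNge gej.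
- by rewrite IHa IHb -big_split; apply: eq_bigr => i _; rewrite scalerDl.
- by rewrite IHa -sumrN; apply: eq_bigr => i _; rewrite scaleNr.
- by rewrite IHa scaler_sumr; apply: eq_bigr => i _; rewrite scalerA.
Qed.

(** Equality of coefficients suffices for equality of the vectors, whatever
    linear relations the atoms satisfy. *)
Lemma leval_eq env e1 e2 :
  all_below (fun i => lcoef e1 i = lcoef e2 i) (size env) ->
  leval env e1 = leval env e2.
Proof.
move=> H; rewrite !leval_lcoef; apply: eq_bigr => i _.
suff ->: lcoef e1 i = lcoef e2 i by [].
case: i => i /=; elim: (size env) H => //= p IH [H1 H2].
by rewrite ltnS leq_eqVlt => /orP[/eqP->|/IH]; auto.
Qed.

End LinearNormalisation.

(* Occurrences of one vector can carry different structure projections, hence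
   the comparison of atoms up to conversion. *)
Ltac lin_in x l :=
  match l with
  | nil => constr:(false)
  | ?y :: _ => let e := constr:(erefl x : x = y) in constr:(true)
  | _ :: ?t => lin_in x t
  end.
Ltac lin_atoms t l :=
  lazymatch t with
  | 0%R => l
  | (?a + ?b)%R => let l1 := lin_atoms a l in lin_atoms b l1
  | (- ?a)%R => lin_atoms a l
  | (_ *: ?a)%R => lin_atoms a l
  | _ => match lin_in t l with true => l | false => constr:(cons t l) end
  end.
Ltac lin_index x l :=
  match l with
  | ?y :: _ => let e := constr:(erefl x : x = y) in constr:(0%N)
  | _ :: ?t => let i := lin_index x t in constr:(S i)
  end.
Ltac lin_reify k t l :=
  lazymatch t with
  | 0%R => constr:(@LZero k)
  | (?a + ?b)%R => let x := lin_reify k a l in let y := lin_reify k b l in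
      constr:(LAdd x y)
  | (- ?a)%R => let x := lin_reify k a l in constr:(LOpp x)
  | (?c *: ?a)%R => let x := lin_reify k a l in constr:(LScale c x)
  | _ => let i := lin_index t l in constr:(@LAtom k i)
  end.
(* The goal is an equality of linear combinations over k of opaque vectors; it
   is reduced to the equalities of the coefficients. *)
Ltac lin_eq k :=
  lazymatch goal with
  | |- @eq ?T ?a ?b =>
    let l := lin_atoms a (@nil T) in
    let l := lin_atoms b l in
    let x := lin_reify k a l in
    let y := lin_reify k b l in
    refine (@leval_eq k _ l x y _)
  end; cbn [lcoef Nat.eqb size all_below]; do ?split.

(** * q-commutators and Serre relations *)

Section QuantumBrackets.

Variables (k : fieldType) (V : lmodType k) (q : k).
Hypotheses (q_neq0 : q != 0) (qint2_neq0 : q ^+ 2 + 1 != 0).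

Implicit Types f g h X Y Z : {linear V -> V}.

Definition comm_op f g := forall v, f (g v) = g (f v).
Definition qcomm_op (c : k) f Y := forall v, f (Y v) = c *: Y (f v).
Definition serre f Y := forall v,
  f (f (Y v)) - (q + q^-1) *: f (Y (f v)) + Y (f (f v)) = 0.
(** The q-commutator, by which every root vector is built from the simple ones.
    With this normalisation the Serre relation for f and Y says exactly that f
    q^-1-commutes with qbr f Y, which is serre_qcomm. *)
Definition qbr f Y : {linear V -> V} := (f \o Y) \- (q \*: (Y \o f)).

(* The generic linearity lemmas also see scaling and opposite as linear maps and
   would exchange them forever; linE f distributes f alone. *)
Definition linE f := (linear0 f, linearD f, linearB f, linearN f, linearZZ f).

Lemma qbrE f Y v : qbr f Y v = f (Y v) - q *: Y (f v).
Proof. by []. Qed.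

(** Subtracting a multiple of a known relation from a goal; a chain of these
    certifies a goal as an explicit combination of relations. *)
Lemma add_multiple (A B L : V) c : L = 0 -> A = B + c *: L -> A = B.
Proof. by move=> -> ->; rewrite scaler0 addr0. Qed.

Lemma qcomm_qbr c f g Y : comm_op f g -> qcomm_op c f Y ->
  qcomm_op c f (qbr g Y).
Proof.
move=> fg fY v; rewrite !qbrE !(linE f) !fg !fY !(linE g) !fg.
by lin_eq k; ring.
Qed.

Lemma comm_qbr f g Y : comm_op f g -> comm_op f Y -> comm_op f (qbr g Y).
Proof.
by move=> fg fY v; rewrite !qbrE !(linE f) !fg !fY !fg.
Qed.

(** The Serre relation is linear in Y, and g passes through it. *)
Lemma serre_qbr f g Y : comm_op f g -> serre f Y -> serre f (qbr g Y).
Proof.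
move=> fg fY v; rewrite !qbrE !(linE f, linE g, linE Y) !fg.
have h1 := congr1 g (fY v); have h2 := fY (g v).
rewrite !(linE g) in h1.
rewrite !fg in h2.
apply: (add_multiple h1 (c := 1)).
apply: (add_multiple h2 (c := - q)).
by lin_eq k; field.
Qed.

(** Here it is Y that passes through the Serre relation of f and g. *)
Lemma serre_qbr_right f g Y : comm_op f Y -> serre f g -> serre f (qbr g Y).
Proof.
move=> fY fg v; rewrite !qbrE !(linE f, linE g, linE Y) !fY.
have h1 := fg (Y v); have h2 := congr1 Y (fg v).
rewrite !(linE Y) in h2.
rewrite !fY in h1.
apply: (add_multiple h1 (c := 1)).
apply: (add_multiple h2 (c := - q)).
by lin_eq k; field.
Qed.

Lemma serre_qcomm f Y : serre f Y -> qcomm_op q^-1 f (qbr f Y).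
Proof.
move=> fY v; rewrite !qbrE !(linE f, linE Y).
apply: (add_multiple (fY v) (c := 1)); lin_eq k; field => //.
Qed.

Lemma qbrC f g Y : comm_op f g -> forall v, qbr f (qbr g Y) v = qbr g (qbr f Y) v.
Proof.
move=> fg v; rewrite !qbrE !(linE f, linE g, linE Y) !fg.
by lin_eq k; field.
Qed.

(** A simple root vector f commutes with the root vector obtained by adding g
    after f: of the four relations f-Y and f-g multiplied by the remaining
    letter on either side, one combination is the commutator itself, and it has
    denominator the quantum integer [2]. *)
Lemma comm_qbr_qbr f g Y : comm_op g Y -> serre f Y -> serre f g ->
  comm_op f (qbr g (qbr f Y)).
Proof.
move=> gY fY fg v; rewrite !qbrE !(linE f, linE g, linE Y) !gY.
have h1 := fY (g v); have h2 := congr1 g (fY v).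
have h3 := fg (Y v); have h4 := congr1 Y (fg v).
rewrite !(linE g) ?gY in h2.
rewrite !(linE Y) in h4.
rewrite !gY in h3.
(* The four multipliers solve the linear system given by the eight words in
   f, f, g, Y with g Y = Y g. *)
apply: (add_multiple h1 (c := - q ^+ 2 / (q + q^-1))).
apply: (add_multiple h2 (c := (q + q^-1)^-1)).
apply: (add_multiple h3 (c := - (q + q^-1)^-1)).
apply: (add_multiple h4 (c := q ^+ 2 / (q + q^-1))).
have q2 : q * q + 1 != 0 by rewrite -expr2.
lin_eq k; field; rewrite ?q_neq0 //.
Qed.

(** Applying f once and twice to X^2 = 0: the first application says that X
    skew-commutes with X' = qbr f X, the second that (1 + q^-2) X'^2 = 0. *)
Lemma qbr_sqr0 f X : serre f X -> (forall v, X (X v) = 0) ->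
  (forall v, X (qbr f X v) = - q^-1 *: qbr f X (X v)) /\
  (forall v, qbr f X (qbr f X v) = 0).
Proof.
move=> fX XX.
have star v : X (qbr f X v) = - q^-1 *: qbr f X (X v).
  rewrite !qbrE !(linE X) !XX (linE f).
  by lin_eq k; field.
split=> // v.
have fX' := serre_qcomm fX.
have fXE w : f (X w) = qbr f X w + q *: X (f w) by rewrite qbrE addrNK.
move: (qbr f X) star fX' fXE => X' star fX' fXE.
have q2 : q * q + 1 != 0 by rewrite -expr2.
have h1 := star (f v); have h2 := congr1 f (star v).
rewrite !(linE f) fXE fX' (fX' (X v)) fXE !(linE X') in h2.
have h3 : X' (X' v) + q *: X (q^-1 *: X' (f v)) + q^-1 *: (q^-1 *: (X' (X' v) + q *: X' (X (f v)))) = 0.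
  by rewrite h2; lin_eq k; field.
rewrite (linE X) h1 in h3.
have : (1 + q^-1 * q^-1) *: X' (X' v) = 0.
  by rewrite -h3; lin_eq k; field.
move/eqP; rewrite scaler_eq0 => /orP[|/eqP//].
have -> : 1 + q^-1 / q = (q * q + 1) / q ^+ 2 by field.
by rewrite mulf_eq0 (negPf q2) invr_eq0 expf_eq0 (negPf q_neq0) andbF.
Qed.

(** The quartic relation is what makes the simple odd vector anticommute with
    the root vector that extends it on both sides; X^2 = 0 alone leaves that
    relation undetermined. *)
Lemma quartic_anticomm f g X : comm_op f g -> (forall v, X (X v) = 0) ->
  (forall v, f (X (g (X v))) + X (f (X (g v))) + g (X (f (X v))) + X (g (X (f v)))
     - (q + q^-1) *: X (f (g (X v))) = 0) ->
  qcomm_op (- 1) X (qbr g (qbr f X)).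
Proof.
move=> fg XX quartic v; rewrite !qbrE !(linE f, linE g, linE X) !XX ?(linE f, linE g) !fg.
have h := quartic v; rewrite !fg in h.
apply: (add_multiple h (c := - q)).
lin_eq k; field => //.
Qed.

End QuantumBrackets.

Section Chains.

Variables (k : fieldType) (V : lmodType k) (q : k).
Hypotheses (q_neq0 : q != 0) (qint2_neq0 : q ^+ 2 + 1 != 0).

(** Root vectors along a line of the Dynkin diagram, starting from Y. *)
Fixpoint chain (g : nat -> {linear V -> V}) (Y : {linear V -> V}) (i : nat) :=
  if i is j.+1 then qbr q (g j) (chain g Y j) else Y.

Lemma qcomm_op1 (f g : {linear V -> V}) : comm_op f g -> qcomm_op 1 f g.
Proof. by move=> fg v; rewrite scale1r. Qed.

(** How the generators of a line meet its root vectors: the next one satisfies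
    a Serre relation, later ones commute, earlier ones commute up to a scalar.
    Only the generator before the last needs an argument, comm_qbr_qbr. *)
Lemma chain_relations (g : nat -> {linear V -> V}) (Y : {linear V -> V}) (K : nat) :
  (forall i j, (i < K)%N -> (j < K)%N -> (i.+1 < j)%N || (j.+1 < i)%N ->
     comm_op (g i) (g j)) ->
  (forall i j, (i < K)%N -> (j < K)%N -> (i == j.+1) || (j == i.+1) ->
     serre q (g i) (g j)) ->
  ((0 < K)%N -> serre q (g 0%N) Y) ->
  (forall i, (0 < i < K)%N -> comm_op (g i) Y) ->
  forall p, (p <= K)%N ->
    [/\ (p < K)%N -> serre q (g p) (chain g Y p),
        forall i, (p < i < K)%N -> comm_op (g i) (chain g Y p)
      & forall i, (i < p)%N -> exists c, qcomm_op c (g i) (chain g Y p)].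
Proof.
move=> gC gS Y0 YC.
have far i p : (p < i < K)%N -> comm_op (g i) (chain g Y p).
  elim: p => [|p IHp] Hp /=; first exact: YC.
  apply: comm_qbr; last by apply: IHp; lia.
  by apply: gC; lia.
have near p : (p < K)%N -> serre q (g p) (chain g Y p).
  case: p => [|p] Hp /=; first exact: Y0.
  apply: serre_qbr_right => //; first by apply: far; lia.
  by apply: gS; rewrite ?eqxx; lia.
move=> p le_pK; split=> [||i lt_ip]; [exact: near|by move=> i; exact: far|].
have [le_p2|gt_p] := leqP p i.+1.
  have -> : p = i.+1 by lia.
  exists q^-1; apply: serre_qcomm => //; apply: near; lia.
exists 1; apply: qcomm_op1; elim: p le_pK lt_ip gt_p => // p IHp le_pK lt_ip gt_p.
have [Ep|lt_p] := eqVneq p i.+1.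
  rewrite Ep /=; apply: comm_qbr_qbr => //.
  - by apply: far; lia.
  - by apply: near; lia.
  - by apply: gS; rewrite ?eqxx ?orbT //; lia.
rewrite /=; apply: comm_qbr; last by apply: IHp; lia.
by apply: gC; lia.
Qed.

End Chains.

(** * Nilpotency of the odd part of the negative half *)

Section OddNilpotency.

Variables (k : fieldType) (V : lmodType k) (q : k) (m n : nat).
Hypotheses (q_neq0 : q != 0) (qint2_neq0 : q ^+ 2 + 1 != 0).
Variable F : nat -> {linear V -> V}.

Definition word (s : seq nat) (v : V) : V := foldr (fun j w => F j w) v s.

Lemma word_cat s1 s2 v : word (s1 ++ s2) v = word s1 (word s2 v).
Proof. by rewrite /word foldr_cat. Qed.

Definition stable (M : V -> Prop) : Prop :=
  [/\ M 0, forall a u v, M u -> M v -> M (a *: u + v)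
    & forall j v, inJ m n j -> M v -> M (F j v)].

Lemma stable_word M s v : stable M -> all (inJ m n) s -> M v -> M (word s v).
Proof.
by case=> _ _ MF; elim: s => //= j s IHs /andP[Jj Js] Mv; apply: MF => //; auto.
Qed.

Lemma stableZ M a v : stable M -> M v -> M (a *: v).
Proof. by case=> M0 MZ _ Mv; rewrite -[_ *: _]addr0; apply: MZ. Qed.

Lemma stableD M u v : stable M -> M u -> M v -> M (u + v).
Proof. by case=> M0 MZ _ Mu Mv; rewrite -[u]scale1r; apply: MZ. Qed.

Lemma stable_qbr M (f Y : {linear V -> V}) : stable M -> (forall v, M v -> M (f v)) ->
  (forall v, M v -> M (Y v)) -> forall v, M v -> M (qbr q f Y v).
Proof.
move=> stM Mf MY v Mv; rewrite qbrE -scaleNr addrC; case: (stM) => _ MZ _.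
by apply: MZ; auto.
Qed.

Lemma split_count (j a b : nat) s : (a + b <= count_mem j s)%N ->
  exists s1 s2, [/\ s = s1 ++ s2, (a <= count_mem j s1)%N & (b <= count_mem j s2)%N].
Proof.
elim: s a => [|i s IHs] a /= Hs.
  by exists [::], [::]; split=> //=; lia.
case: a Hs => [|a] Hs; first by exists [::], (i :: s); split=> //=; lia.
have [|s1 [s2 [-> H1 H2]]] := IHs (a.+1 - (i == j))%N; first by case: (i == j) Hs => /=; lia.
by exists (i :: s1), s2; split=> //=; case: (i == j) H1 => /=; lia.
Qed.

(** The reason why only finitely many odd letters survive.  Suppose that Y_0,
    ..., Y_(N-1) square to zero and that each Y_e commutes up to a scalar with
    every F_a modulo the earlier ones.  If the earlier ones map a stable M into
    a stable M', then M'' = Y_e M + M' is stable, and Y_e maps both M into M''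
    and M'' into M'.  So the number of factors F_m needed to map M into M' at
    most doubles when Y_e is treated, and it is one when F_m itself is among
    the Y_i with i < e. *)
Lemma normal_chain_nilpotent (N : nat) (Y : nat -> {linear V -> V}) :
  (forall M e v, stable M -> (e < N)%N -> M v -> M (Y e v)) ->
  (forall a e, inJ m n a -> (e < N)%N -> exists c,
     (forall v, F a (Y e v) = c *: Y e (F a v)) \/
     exists2 i, (i < e)%N & forall v, F a (Y e v) = c *: Y e (F a v) + Y i v) ->
  (forall e v, (e < N)%N -> Y e (Y e v) = 0) ->
  (exists2 e, (e < N)%N & forall v, Y e v = F m v) ->
  forall s v, all (inJ m n) s -> (2 ^ N <= count_mem m s)%N -> word s v = 0.
Proof.
move=> Yst Ynorm Ysqr [e0 lt_e0 Ye0].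
suff step d e : (e + d = N)%N -> forall M M' : V -> Prop, stable M -> stable M' ->
    (forall v, M' v -> M v) ->
    (forall i v, (i < e)%N -> M v -> M' (Y i v)) ->
    forall s v, all (inJ m n) s -> (2 ^ d <= count_mem m s)%N -> M v -> M' (word s v).
  move=> s v Js Hs.
  apply: (step N 0%N _ (fun _ => True) (fun x => x = 0) _ _ _ _ s v) => //.
  split=> // [a u w -> ->|j w _ ->]; first by rewrite scaler0 addr0.
  by rewrite linear0.
elim: d e => [|d IHd] e He M M' stM stM' subM Hi s v Js Hs Mv.
  have [s1 [s2 [Es H1 H2]]] : exists s1 s2, [/\ s = s1 ++ m :: s2, True & True].
    have ms : m \in s by rewrite -has_pred1 has_count; lia.
    by case/splitPr: ms => s1 s2; exists s1, s2.
  move: Js; rewrite Es all_cat /= => /and3P[J1 Jm J2].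
  rewrite word_cat; apply: stable_word => //=; rewrite -Ye0.
  by apply: Hi; [lia|apply: stable_word].
have lt_eN : (e < N)%N by lia.
pose M'' v := exists y z, [/\ M y, M' z & v = Y e y + z].
have stM'' : stable M''.
  split.
  - by exists 0, 0; rewrite linear0 addr0; split=> //; [case: stM|case: stM'].
  - move=> a _ _ [y1 [z1 [My1 Mz1 ->]]] [y2 [z2 [My2 Mz2 ->]]].
    exists (a *: y1 + y2), (a *: z1 + z2); split; [by case: stM; auto|by case: stM'; auto|].
    by rewrite !(linE (Y e)); lin_eq k; ring.
  - move=> j _ Jj [y [z [My Mz ->]]]; rewrite linearD.
    have MFz : M' (F j z) by case: stM' => _ _; apply.
    have MFy : M (F j y) by case: stM => _ _; apply.
    have [c [->|[i lt_ie ->]]] := Ynorm j e Jj lt_eN; rewrite -?(linearZZ (Y e)).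
      by exists (c *: F j y), (F j z); split=> //; apply: stableZ.
    exists (c *: F j y), (Y i y + F j z); rewrite addrA; split=> //.
      exact: stableZ.
    by apply: stableD => //; apply: Hi.
have subM'' x : M'' x -> M x.
  by move=> [y [z [My Mz ->]]]; apply: stableD => //; [exact: Yst|exact: subM].
have subM' x : M' x -> M'' x.
  move=> Mx; exists 0, x; rewrite linear0 add0r; split=> //; by case: stM.
move: Hs; rewrite expnS mul2n -addnn => /split_count[s1 [s2 [Es H1 H2]]].
move: Js; rewrite Es all_cat => /andP[J1 J2]; rewrite word_cat.
have M2 : M'' (word s2 v).
  apply: (IHd e.+1 _ M M'') => //; first lia.
  move=> i w; rewrite ltnS leq_eqVlt => /orP[/eqP->|lt_ie] Mw; last by apply: subM'; auto.
  by exists w, 0; rewrite addr0; split=> //; case: stM'.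
apply: (IHd e.+1 _ M'' M') => //; first lia.
move=> i w; rewrite ltnS leq_eqVlt => /orP[/eqP->|lt_ie] Mw; last by apply: Hi; auto.
case: Mw => y [z [My Mz ->]]; rewrite linearD Ysqr // add0r; exact: Yst.
Qed.

Hypotheses (m_gt0 : (0 < m)%N) (F_serre : Serre_relations q m n F).

Lemma F_comm i j : inJ m n i -> inJ m n j -> ((i.+1 < j) || (j.+1 < i))%N ->
  comm_op (F i) (F j).
Proof. by case: F_serre => H _ _ _ Ji Jj ij v; apply: H. Qed.

Lemma F_serre_adj i j : inJ m n i -> inJ m n j -> (i == j.+1) || (j == i.+1) ->
  i != m -> serre q (F i) (F j).
Proof. by case: F_serre => _ H _ _ Ji Jj ij im v; apply: H. Qed.

Let left_gen i := F (m.-1 - i).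
Let right_gen i := F (i + m.+1).

(** The odd root vector of the root epsilon_(m-p) - epsilon_(m+1+r): starting
    from F_m, the generators F_(m-1), ..., F_(m-p) and then F_(m+1), ...,
    F_(m+r) are added. *)
Definition root_vector (p r : nat) : {linear V -> V} :=
  chain q right_gen (chain q left_gen (F m) p) r.

Local Notation X := root_vector.

Lemma root_vector_stable M p r v : stable M -> (p < m)%N -> (r < n)%N ->
  M v -> M (X p r v).
Proof.
move=> stM lt_pm lt_rn; rewrite /root_vector.
have MF j w : inJ m n j -> M w -> M (F j w) by case: (stM) => _ _; apply.
elim: r lt_rn v => [|r IHr] lt_rn /=.
  elim: p lt_pm => [|p IHp] lt_pm v /=; first by apply: MF; rewrite /inJ; lia.
  apply: stable_qbr => // w; last by apply: IHp; lia.
  by apply: MF; rewrite /inJ; lia.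
move=> v; apply: stable_qbr => // w; last by apply: IHr; lia.
by apply: MF; rewrite /inJ; lia.
Qed.

Lemma left_chain p : (0 < n)%N -> (p < m)%N ->
  [/\ (p < m.-1)%N -> serre q (left_gen p) (chain q left_gen (F m) p),
      forall i, (p < i < m.-1)%N -> comm_op (left_gen i) (chain q left_gen (F m) p)
    & forall i, (i < p)%N -> exists c, qcomm_op c (left_gen i) (chain q left_gen (F m) p)].
Proof.
move=> n_gt0 lt_pm; apply: chain_relations => //; rewrite /left_gen.
- by move=> i j ? ? ?; rewrite /left_gen /right_gen; apply: F_comm; rewrite /inJ; lia.
- by move=> i j ? ? ?; rewrite /left_gen /right_gen; apply: F_serre_adj; rewrite /inJ; lia.
- by move=> ?; rewrite /left_gen /right_gen; apply: F_serre_adj; rewrite /inJ; lia.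
- by move=> i ?; rewrite /left_gen /right_gen; apply: F_comm; rewrite /inJ; lia.
- lia.
Qed.

Lemma right_base p : (p < m)%N ->
  ((0 < n.-1)%N -> serre q (right_gen 0) (chain q left_gen (F m) p)) /\
  (forall i, (0 < i < n.-1)%N -> comm_op (right_gen i) (chain q left_gen (F m) p)).
Proof.
elim: p => [|p IHp] lt_pm; split; rewrite /right_gen /=.
- by move=> ?; rewrite /left_gen /right_gen; apply: F_serre_adj; rewrite /inJ; lia.
- by move=> i ?; rewrite /left_gen /right_gen; apply: F_comm; rewrite /inJ; lia.
- move=> n_gt1; apply: serre_qbr => //; first by rewrite /left_gen /right_gen; apply: F_comm; rewrite /inJ; lia.
  by have [|H _] := IHp; [lia|apply: H].
- move=> i Hi; apply: comm_qbr => //; first by rewrite /left_gen /right_gen; apply: F_comm; rewrite /inJ; lia.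
  by have [|_ H] := IHp; [lia|apply: H].
Qed.

Lemma right_chain p r : (p < m)%N -> (r < n)%N ->
  [/\ (r < n.-1)%N -> serre q (right_gen r) (X p r),
      forall i, (r < i < n.-1)%N -> comm_op (right_gen i) (X p r)
    & forall i, (i < r)%N -> exists c, qcomm_op c (right_gen i) (X p r)].
Proof.
move=> lt_pm lt_rn; have [base1 base2] := right_base lt_pm.
apply: chain_relations => //; rewrite /right_gen.
- by move=> i j ? ? ?; rewrite /left_gen /right_gen; apply: F_comm; rewrite /inJ; lia.
- by move=> i j ? ? ?; rewrite /left_gen /right_gen; apply: F_serre_adj; rewrite /inJ; lia.
- lia.
Qed.

(** The order in which the two sides are extended does not matter. *)
Lemma root_vectorS p r : (p.+1 < m)%N -> (r < n)%N ->
  forall v, X p.+1 r v = qbr q (left_gen p) (X p r) v.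
Proof.
move=> lt_pm; elim: r => [|r IHr] lt_rn v //.
have C : comm_op (left_gen p) (right_gen r) by rewrite /left_gen /right_gen; apply: F_comm; rewrite /inJ; lia.
by rewrite (qbrC q _ C) !qbrE -!/(X _ r) !IHr //; lia.
Qed.

Lemma qcomm_ext c (f Y Y' : {linear V -> V}) : (forall v, Y v = Y' v) ->
  qcomm_op c f Y -> qcomm_op c f Y'.
Proof. by move=> E H v; rewrite -!E H. Qed.

Lemma left_qcomm i p r : (p < m)%N -> (r < n)%N -> (i < m.-1)%N -> i != p ->
  exists c, qcomm_op c (left_gen i) (X p r).
Proof.
move=> lt_pm lt_rn lt_im neq; elim: r lt_rn => [|r IHr] lt_rn.
  have [_ H1 H2] := left_chain lt_rn lt_pm.
  have [/H2//|gt] := ltnP i p; exists 1; apply: qcomm_op1; apply: H1; lia.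
have [|c Hc] := IHr; first lia.
by exists c; apply: qcomm_qbr => //; rewrite /left_gen /right_gen; apply: F_comm; rewrite /inJ; lia.
Qed.

(** F_m^2 = 0 propagates to all odd root vectors. *)
Lemma root_vector_sqr p r v : (p < m)%N -> (r < n)%N -> X p r (X p r v) = 0.
Proof.
move=> lt_pm; elim: r v => [|r IHr] v lt_rn.
  rewrite /root_vector /=; elim: p lt_pm v => [|p IHp] lt_pm v /=.
    by case: F_serre => _ _ H _; apply: H; rewrite /inJ; lia.
  have [|H _ _] := left_chain lt_rn (p := p); first lia.
  have [||_ H'] := qbr_sqr0 q_neq0 qint2_neq0 (H _); first lia.
    by move=> w; apply: IHp; lia.
  exact: H'.
have [|H _ _] := right_chain lt_pm (r := r); first lia.
have [||_ H'] := qbr_sqr0 q_neq0 qint2_neq0 (H _); first lia.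
  by move=> w; apply: IHr; lia.
exact: H'.
Qed.

(** The simple odd vector commutes with every odd root vector up to a scalar,
    exactly and not only modulo others.  On the two lines through F_m this comes
    from F_m^2 = 0, off them from the quartic relation. *)
Lemma root_vector_Fm p r : (p < m)%N -> (r < n)%N ->
  exists c, qcomm_op c (F m) (X p r).
Proof.
move=> lt_pm; elim: r => [|r IHr] lt_rn.
  elim: p lt_pm => [|p IHp] lt_pm.
    by exists 1 => v; rewrite scale1r.
  have [E|p_gt0] := posnP p.
    subst p; have [|H _ _] := left_chain lt_rn (p := 0); first lia.
    have [||H' _] := qbr_sqr0 q_neq0 qint2_neq0 (H _); first lia.
      by move=> w; apply: (@root_vector_sqr 0 0); lia.
    by exists (- q^-1).
  have [|c Hc] := IHp; first lia.
  by exists c; apply: qcomm_qbr => //; rewrite /left_gen /right_gen; apply: F_comm; rewrite /inJ; lia.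
have [E|r_gt0] := posnP r; last first.
  have [|c Hc] := IHr; first lia.
  by exists c; apply: qcomm_qbr => //; rewrite /left_gen /right_gen; apply: F_comm; rewrite /inJ; lia.
subst r; elim: p lt_pm {IHr} => [|p IHp] lt_pm.
  have [|H _ _] := right_chain lt_pm (r := 0); first lia.
  have [||H' _] := qbr_sqr0 q_neq0 qint2_neq0 (H _); first lia.
    by move=> w; apply: (@root_vector_sqr 0 0); lia.
  by exists (- q^-1).
have [E|p_gt0] := posnP p; last first.
  have [|c Hc] := IHp; first lia.
  exists c; apply: (qcomm_ext (Y := qbr q (left_gen p) (X p 1))).
    by move=> v; rewrite root_vectorS.
  by apply: qcomm_qbr => //; rewrite /left_gen /right_gen; apply: F_comm; rewrite /inJ; lia.
subst p; exists (- 1); rewrite /root_vector /= /left_gen subn0 /right_gen add0n.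
apply: quartic_anticomm => //.
- by rewrite /left_gen /right_gen; apply: F_comm; rewrite /inJ; lia.
- by move=> w; apply: (@root_vector_sqr 0 0); lia.
- by move=> v; case: F_serre => _ _ _; apply; rewrite /inJ; lia.
Qed.

(** The part of the Poincare-Birkhoff-Witt theorem that is needed: the odd part
    of the negative half is nilpotent.  The mn odd root vectors, ordered from
    the highest root down to F_m, form a chain as in normal_chain_nilpotent. *)
Lemma odd_words_nilpotent : exists N : nat, forall s v, all (inJ m n) s ->
  (N <= count_mem m s)%N -> word s v = 0.
Proof.
have [n0|n_gt0] := posnP n.
  exists 1%N => s v Js; rewrite -has_count has_pred1 => ms.
  by move/allP: Js => /(_ _ ms); rewrite /inJ; lia.
have pred_subn_lt a b : (0 < a)%N -> (a.-1 - b < a)%N by lia.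
(* The highest root comes first; for fixed p the index r decreases. *)
pose Y e := X (m.-1 - e %/ n) (n.-1 - e %% n).
have index p r : (p < m)%N -> (r < n)%N ->
    ((m.-1 - p) * n + (n.-1 - r) < m * n)%N /\
    forall v, Y ((m.-1 - p) * n + (n.-1 - r))%N v = X p r v.
  move=> lt_pm lt_rn; split; first by nia.
  move=> v; rewrite /Y divnMDl // modnMDl divn_small ?modn_small; try lia.
  by congr (X _ _ v); lia.
exists (2 ^ (m * n))%N => s v Js Hs.
apply: (@normal_chain_nilpotent (m * n) Y) => // [M e w stM lt_e Mw|a e Ja lt_e|e w lt_e|].
- by apply: root_vector_stable => //; apply: pred_subn_lt.
- have lt_d : (e %/ n < m)%N by rewrite ltn_divLR.
  have lt_r : (e %% n < n)%N by rewrite ltn_mod.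
  rewrite /Y; set p := (m.-1 - _)%N; set r := (n.-1 - _)%N.
  have lt_pm : (p < m)%N by apply: pred_subn_lt.
  have lt_rn : (r < n)%N by apply: pred_subn_lt.
  have Ee : e = ((m.-1 - p) * n + (n.-1 - r))%N.
    by rewrite [LHS](divn_eq e n) /p /r; congr (_ * _ + _)%N; lia.
  have [Ea|neq_am] := eqVneq a m.
    subst a.
    by have [c Hc] := root_vector_Fm lt_pm lt_rn; exists c; left.
  have [lt_am|ge_am] := ltnP a m.
    have Ea : F a = left_gen (m.-1 - a) by rewrite /left_gen; congr F; move: Ja; rewrite /inJ; lia.
    have [Ep|neq_p] := eqVneq (m.-1 - a)%N p; last first.
      have [|c Hc] := left_qcomm lt_pm lt_rn (i := (m.-1 - a)%N) _ neq_p.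
        by move: Ja; rewrite /inJ; lia.
      by exists c; left; rewrite Ea.
    have lt_p1 : (p.+1 < m)%N by move: Ja; rewrite /inJ; lia.
    have [_ Hi] := index _ _ lt_p1 lt_rn.
    exists q; right; exists ((m.-1 - p.+1) * n + (n.-1 - r))%N.
      by rewrite Ee ltn_add2r ltn_mul2r n_gt0 /=; lia.
    move=> w; rewrite Hi root_vectorS // qbrE Ea Ep; lin_eq k; ring.
  have Ea : F a = right_gen (a - m.+1) by rewrite /right_gen; congr F; lia.
  have [Er|neq_r] := eqVneq (a - m.+1)%N r; last first.
    have [_ H1 H2] := right_chain lt_pm lt_rn.
    have [/H2[c Hc]|gt] := ltnP (a - m.+1)%N r; first by exists c; left; rewrite Ea.
    exists 1; left; rewrite Ea; apply: qcomm_op1; apply: H1.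
    by move: Ja; rewrite /inJ; lia.
  have lt_r1 : (r.+1 < n)%N by move: Ja; rewrite /inJ; lia.
  have [_ Hi] := index _ _ lt_pm lt_r1.
  exists q; right; exists ((m.-1 - p) * n + (n.-1 - r.+1))%N; first by rewrite Ee; lia.
  move=> w; rewrite Hi Ea Er.
  have -> : X p r.+1 w = qbr q (right_gen r) (X p r) w by [].
  rewrite qbrE; lin_eq k; ring.
- by apply: root_vector_sqr; apply: pred_subn_lt.
- have [H1 H2] := index 0%N 0%N m_gt0 n_gt0.
  by exists ((m.-1 - 0) * n + (n.-1 - 0))%N.
Qed.

End OddNilpotency.

(** * Weights *)

Section Eigenvectors.

Variables (k : fieldType) (V : lmodType k) (T : {linear V -> V}).

(** The product of the T - c for c in r, applied to v. *)
Definition kill (r : seq k) (v : V) : V := foldr (fun c w => T w - c *: w) v r.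

Lemma kill_sum I (p : seq I) P (x : I -> V) r :
  kill r (\sum_(a <- p | P a) x a) = \sum_(a <- p | P a) kill r (x a).
Proof.
elim: r => //= c r ->; rewrite linear_sum scaler_sumr -sumrB; exact: eq_bigr.
Qed.

Lemma kill_eigen mu v r : T v = mu *: v ->
  kill r v = (\prod_(c <- r) (mu - c)) *: v.
Proof.
move=> Tv; elim: r => [|c r /= ->]; first by rewrite big_nil scale1r.
by rewrite big_cons linearZZ Tv; lin_eq k; ring.
Qed.

(** Eigenvectors for different eigenvalues are independent, in the form used to
    select one weight from an arbitrary combination. *)
Lemma eigen_component (I : eqType) (p : seq I) (x : I -> V) (mu : I -> k) nu y :
  {in p, forall a, T (x a) = mu a *: x a} -> T y = nu *: y ->
  \sum_(a <- p) x a = y -> \sum_(a <- p | mu a == nu) x a = y.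
Proof.
move=> Tx Ty Sy; set z := \sum_(a <- p | _) _.
have Tz : T z = nu *: z.
  rewrite linear_sum scaler_sumr big_seq_cond [RHS]big_seq_cond.
  by apply: eq_bigr => a /andP[pa /eqP <-]; apply: Tx.
have Tyz : T (y - z) = nu *: (y - z) by rewrite linearB Ty Tz scalerBr.
have yzE : y - z = \sum_(a <- p | mu a != nu) x a.
  rewrite -Sy (bigID (fun a => mu a == nu)) /= -/z addrAC subrr add0r //.
pose r := [seq mu a | a <- p & mu a != nu].
have : kill r (y - z) = 0.
  rewrite yzE kill_sum big_seq_cond big1 // => a /andP[pa Ha].
  rewrite (kill_eigen _ (Tx a pa)); apply/eqP; rewrite scaler_eq0; apply/orP; left.
  rewrite prodf_seq_eq0; apply/hasP; exists (mu a); last by rewrite subrr /=.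
  by apply/mapP; exists a => //; rewrite mem_filter Ha.
rewrite (kill_eigen _ Tyz) => /eqP; rewrite scaler_eq0 => /orP[|].
  rewrite prodf_seq_eq0 => /hasP[c /mapP[a]]; rewrite mem_filter => /andP[ne _] ->.
  by rewrite /= subr_eq0 => /eqP E; rewrite E eqxx in ne.
by rewrite subr_eq0 => /eqP.
Qed.

End Eigenvectors.

Section HighestWeight.

Variables (X : version) (k : fieldType) (q : k) (m n : nat).
Hypothesis q_neq0 : q != 0.

Lemma qi_neq0 i : qi q m i != 0.
Proof. by rewrite /qi; case: ifP => _ //; rewrite invr_eq0. Qed.

Lemma Kchar_neq0 i j : Kchar q m i j != 0.
Proof. by rewrite expfz_neq0 ?qi_neq0. Qed.

Lemma torus_char_neq0 i j : torus_char X q m i j != 0.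
Proof.
rewrite /torus_char; case: X; first exact: Kchar_neq0.
by rewrite mulf_neq0 ?invr_eq0 ?Kchar_neq0.
Qed.

(** The eigenvalues of K_i and of the ratio K_i / K_(i+1) on the vector obtained
    from a highest weight vector of weight lam by the word s in the F_j. *)
Definition torus_eigen (lam : weight) i (s : seq nat) : k :=
  (\prod_(j <- s) (torus_char X q m i j)^-1) * q ^ torus_weight X m n lam i.

Definition ratio_eigen (lam : weight) i (s : seq nat) : k :=
  if X is GL then torus_eigen lam i s / torus_eigen lam i.+1 s
  else torus_eigen lam i s.

Lemma torus_eigen_neq0 lam i s : torus_eigen lam i s != 0.
Proof.
rewrite mulf_neq0 ?expfz_neq0 //; elim: s => [|j s IHs].
  by rewrite big_nil oner_neq0.
by rewrite big_cons mulf_neq0 ?invr_eq0 ?torus_char_neq0.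
Qed.

Section OneModule.

Variables (V : lmodType k) (A : action V) (lam : weight) (v : V).
Hypotheses (modA : is_module X q m n A) (hwv : highest_weight_vector X q m n A lam v).

Local Notation word := (word (actF A)).

Lemma word_torus s i : all (inJ m n) s -> inTorus X m n i ->
  actK A i (word s v) = torus_eigen lam i s *: word s v /\
  actKV A i (word s v) = (torus_eigen lam i s)^-1 *: word s v.
Proof.
case: modA => [[_ KKV _ KF] _ _ _ _] Js Ti.
have KE : actK A i (word s v) = torus_eigen lam i s *: word s v.
  elim: s Js => [_|j s IHs /= /andP[Jj Js]].
    by rewrite /torus_eigen big_nil mul1r; case: hwv => _ _; apply.
  rewrite KF // IHs // linearZZ scalerA; congr (_ *: _).
  by rewrite /torus_eigen big_cons mulrA.
split=> //; have [_ KVK] := KKV i (word s v) Ti.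
rewrite KE linearZZ in KVK; rewrite -{2}KVK scalerA mulVf ?scale1r //.
exact: torus_eigen_neq0.
Qed.

Lemma word_ratio s i : all (inJ m n) s -> inJ m n i ->
  calK X A i (word s v) = ratio_eigen lam i s *: word s v /\
  calKV X A i (word s v) = (ratio_eigen lam i s)^-1 *: word s v.
Proof.
move=> Js Ji; have H i' := @word_torus s i' Js.
have T1 : inTorus X m n i by move: Ji; rewrite /inTorus /inJ; case: X => //; lia.
rewrite /calK /calKV /ratio_eigen; move: H T1; case: X => H T1; last exact: H.
have T2 : inTorus GL m n i.+1 by move: Ji; rewrite /inTorus /inJ; lia.
have [K1 KV1] := H _ T1; have [K2 KV2] := H _ T2.
rewrite KV2 K2 !linearZZ K1 KV1 !scalerA invf_div; split=> //.
by rewrite mulrC.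
Qed.

Definition comb (p : seq (k * seq nat)) : V := \sum_(cs <- p) cs.1 *: word cs.2 v.

Lemma comb_cat p1 p2 : comb (p1 ++ p2) = comb p1 + comb p2.
Proof. exact: big_cat. Qed.

Lemma comb_scale a p : comb [seq (a * cs.1, cs.2) | cs <- p] = a *: comb p.
Proof.
by rewrite /comb big_map scaler_sumr; apply: eq_bigr => cs _; rewrite scalerA.
Qed.

End OneModule.

End HighestWeight.

(** * Simple modules of a given highest weight *)

Section Nilpotent.

Variables (X : version) (k : fieldType) (q : k) (m n : nat).
Hypothesis q_neq0 : q != 0.
Variable lam : weight.

Variable lev : seq nat -> nat.
Hypothesis lev_cat : forall s1 s2, lev (s1 ++ s2) = (lev s1 + lev s2)%N.
Hypothesis lev_gt0 : forall s, all (inJ m n) s -> s != [::] ->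
  (forall i, inJ m n i -> ratio_eigen X q m n lam i s = ratio_eigen X q m n lam i [::]) ->
  (0 < lev s)%N.

Section OneModule.

Variables (V : lmodType k) (A : action V) (v : V).
Hypotheses (modA : is_module X q m n A) (hwv : highest_weight_vector X q m n A lam v).

Local Notation word := (word (actF A)).
Local Notation comb := (comb A v).

Definition Jcomb (p : seq (k * seq nat)) : bool := all (fun cs => all (inJ m n) cs.2) p.

Lemma word_linear s a u w : word s (a *: u + w) = a *: word s u + word s w.
Proof. by elim: s => //= j s ->; rewrite (linE (actF A j)) (linE (actF A j)). Qed.

Lemma word_comb s p : word s (comb p) = comb [seq (cs.1, s ++ cs.2) | cs <- p].
Proof.
rewrite /comb big_map; elim: p => [|cs p IHp].
  rewrite !big_nil; elim: s => //= j s ->; exact: linear0.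
by rewrite !big_cons word_linear IHp word_cat.
Qed.

(** A combination of words of positive level with v as a fixed point can be
    iterated, and then words of any high level still combine to v. *)
Lemma comb_fixed_eq0 N p :
  (forall s, all (inJ m n) s -> (N <= lev s)%N -> word s v = 0) ->
  Jcomb p -> all (fun cs => 0 < lev cs.2)%N p -> comb p = v -> v = 0.
Proof.
move=> nilN Jp levp Ep.
have [p' [Jp' levp' <-]] : exists p', [/\ Jcomb p', all (fun cs => N <= lev cs.2)%N p' & comb p' = v].
  elim: N {nilN} => [|N [p' [Jp' levp' Ep']]].
    exists p; split=> //; exact/allP.
  pose P := flatten [seq [seq (cs'.1 * cs.1, cs'.2 ++ cs.2) | cs <- p] | cs' <- p'].
  exists P; split.
  - apply/allP => cs /flattenP[_ /mapP[c1 H1 ->] /mapP[c2 H2 ->]] /=.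
    by rewrite all_cat (allP Jp' _ H1) (allP Jp _ H2).
  - apply/allP => cs /flattenP[_ /mapP[c1 H1 ->] /mapP[c2 H2 ->]] /=.
    by rewrite lev_cat; have := allP levp' _ H1; have := allP levp _ H2; lia.
  - rewrite -{2}Ep' /P; elim: p' {P Jp' levp' Ep'} => [|c1 p' IH] /=.
      by rewrite /comb !big_nil.
    rewrite comb_cat IH [in RHS]/comb big_cons -/(comb p'); congr (_ + _).
    rewrite -{2}Ep word_comb -comb_scale -map_comp; congr comb.
rewrite /comb big_seq big1 // => cs pcs.
by rewrite nilN ?scaler0 //; [exact: (allP Jp' _ pcs)|exact: (allP levp' _ pcs)].
Qed.

(** The words whose value on the highest weight vector has the highest weight,
    as seen by the ratios K_i / K_(i+1) for i in l. *)
Definition trivial_part (l : seq nat) (p : seq (k * seq nat)) :=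
  [seq cs <- p | all (fun i => ratio_eigen X q m n lam i cs.2 == ratio_eigen X q m n lam i [::]) l].

Lemma comb_trivial_part l c p : all (inJ m n) l -> Jcomb p -> comb p = c *: v ->
  comb (trivial_part l p) = c *: v.
Proof.
move=> Jl Jp Ep; elim: l Jl => [_|i l IHl /= /andP[Ji Jl]].
  by rewrite /trivial_part /= filter_predT.
pose T : {linear V -> V} := if X is GL then actK A i \o actKV A i.+1 else actK A i.
have TE u : T u = calK X A i u by rewrite /T /calK; case: X.
have Tw s : all (inJ m n) s -> T (word s v) = ratio_eigen X q m n lam i s *: word s v.
  by move=> Js; rewrite TE; case: (word_ratio q_neq0 modA hwv Js Ji).
have := @eigen_component _ _ T _ (trivial_part l p) (fun cs => cs.1 *: word cs.2 v)
  (fun cs => ratio_eigen X q m n lam i cs.2) (ratio_eigen X q m n lam i [::]) (c *: v).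
rewrite /trivial_part in IHl *; move=> H.
rewrite -[RHS]H.
- by rewrite /comb !big_filter big_filter_cond; apply: eq_bigl => cs; rewrite andbC.
- move=> cs; rewrite mem_filter => /andP[_ pcs].
  by rewrite (linE T) Tw ?(allP Jp _ pcs) // !scalerA mulrC.
- by rewrite (linE T) (Tw [::]) // !scalerA mulrC.
- exact: IHl.
Qed.

Lemma comb_empty_words p :
  comb p = (\sum_(cs <- p | cs.2 == [::]) cs.1) *: v + comb [seq cs <- p | cs.2 != [::]].
Proof.
rewrite /comb (bigID (fun cs => cs.2 == [::])) /= big_filter; congr (_ + _).
by rewrite scaler_suml; apply: eq_bigr => cs /eqP ->.
Qed.

Definition lev_nilpotent := exists N : nat, forall s,
  all (inJ m n) s -> (N <= lev s)%N -> word s v = 0.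

(** Let a combination of words map v to c v.  By independence of weights its words
    of trivial weight do so already, and the nonempty ones among these contribute
    a multiple of v that has to vanish by comb_fixed_eq0.  So c is the total
    coefficient of the empty word, a number that does not depend on the module. *)
Lemma trivial_comb_fixed c p : lev_nilpotent -> Jcomb p -> c *: v = comb p ->
  \sum_(cs <- trivial_part (iota 1 (m + n).-1) p | cs.2 == [::]) cs.1 = c.
Proof.
move=> [N nilN] Jp Ep; set l := iota _ _.
have lJ i : (i \in l) = inJ m n i by rewrite mem_iota /inJ; lia.
have Jl : all (inJ m n) l by apply/allP => i; rewrite lJ.
have := comb_trivial_part Jl Jp (esym Ep).
set p' := trivial_part l p; set c' := \sum_(cs <- _ | _) _ => E.
have Jp' : Jcomb p' by apply/allP => cs; rewrite mem_filter => /andP[_]; apply: (allP Jp).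
(* The nonempty words of trivial weight combine to (c - c') v; if c differs from
   c' they can be rescaled to fix v. *)
pose p1 := [seq ((c - c')^-1 * cs.1, cs.2) | cs <- p' & cs.2 != [::]].
have [/eqP|ne] := eqVneq (c - c') 0; first by rewrite subr_eq0 => /eqP.
have v0 : v != 0 by case: hwv.
case/eqP: v0; apply: (@comb_fixed_eq0 N p1) => //.
- by apply/allP => c0 /mapP[cs]; rewrite mem_filter => /andP[_ pcs] ->; apply: (allP Jp' _ pcs).
- apply/allP => c0 /mapP[cs]; rewrite mem_filter => /andP[Hcs pcs] -> /=.
  apply: lev_gt0 => //; first exact: (allP Jp' _ pcs).
  move=> i Ji; apply/eqP; move: pcs; rewrite mem_filter => /andP[/allP H _].
  by apply: H; rewrite lJ.
- rewrite /p1 comb_scale; apply: (canLR (scalerK ne)).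
  by move: E; rewrite comb_empty_words -/c' scalerBl => <-; rewrite addrAC subrr add0r.
Qed.

End OneModule.

End Nilpotent.

Section Uniqueness.

Variables (X : version) (k : fieldType) (q : k) (m n : nat).
Hypothesis q_neq0 : q != 0.
Variable lam : weight.

Lemma simple_generated (V : lmodType k) (A : action V) (W : V -> Prop) v :
  is_simple X m n A -> is_submodule X m n A W -> v != 0 -> W v -> forall u, W u.
Proof.
case=> _ H /H[W0|//] vn0 Wv; by rewrite (W0 _ Wv) eqxx in vn0.
Qed.

Section Related.

Variables (V V' : lmodType k) (A : action V) (A' : action V') (v : V) (v' : V').
Hypotheses (modA : is_module X q m n A) (hwv : highest_weight_vector X q m n A lam v).
Hypotheses (modA' : is_module X q m n A') (hwv' : highest_weight_vector X q m n A' lam v').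

(** The submodule of the direct sum of V and V' generated by (v, v'), seen as a
    relation. *)
Definition related (x : V) (x' : V') := exists p : seq (k * seq nat),
  [/\ Jcomb m n p, x = comb A v p & x' = comb A' v' p].

Lemma related0 : related 0 0.
Proof. by exists [::]; rewrite /comb !big_nil. Qed.

Lemma relatedZD a x x' y y' : related x x' -> related y y' ->
  related (a *: x + y) (a *: x' + y').
Proof.
move=> [p [Jp -> ->]] [r [Jr -> ->]].
exists ([seq (a * cs.1, cs.2) | cs <- p] ++ r); rewrite !comb_cat !comb_scale; split=> //.
by rewrite /Jcomb all_cat all_map; apply/andP.
Qed.

Lemma relatedZ a x x' : related x x' -> related (a *: x) (a *: x').
Proof. by move=> H; rewrite -[_ *: x]addr0 -[_ *: x']addr0; apply: relatedZD H related0. Qed.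

Lemma relatedD x x' y y' : related x x' -> related y y' -> related (x + y) (x' + y').
Proof. by move=> H1 H2; rewrite -[x]scale1r -[x']scale1r; apply: relatedZD. Qed.

Lemma related_sum d (c : 'I_d -> k) (x : 'I_d -> V) (x' : 'I_d -> V') :
  (forall i, related (x i) (x' i)) -> related (\sum_i c i *: x i) (\sum_i c i *: x' i).
Proof.
by move=> H; apply: big_ind2 => [|x1 x2 y1 y2|i _]; [exact: related0|exact: relatedD|exact: relatedZ].
Qed.

Lemma related_word s : all (inJ m n) s -> related (word (actF A) s v) (word (actF A') s v').
Proof.
by move=> Js; exists [:: (1, s)]; rewrite /Jcomb /comb !big_seq1 /= Js !scale1r.
Qed.

Lemma related_map (T : {linear V -> V}) (T' : {linear V' -> V'}) :
  (forall s, all (inJ m n) s ->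
     related (T (word (actF A) s v)) (T' (word (actF A') s v'))) ->
  forall x x', related x x' -> related (T x) (T' x').
Proof.
move=> H _ _ [p [Jp -> ->]]; rewrite /comb; elim: p Jp => [_|cs p IHp /= /andP[Js Jp]].
  by rewrite !big_nil !linear0; apply: related0.
by rewrite !big_cons (linE T) (linE T') (linE T) (linE T'); apply: relatedZD (H _ Js) (IHp Jp).
Qed.

Lemma relatedF j x x' : inJ m n j -> related x x' -> related (actF A j x) (actF A' j x').
Proof.
move=> Jj; apply: related_map => s Js.
by apply: (@related_word (j :: s)); rewrite /= Jj.
Qed.

Lemma related_torus i x x' : inTorus X m n i -> related x x' ->
  related (actK A i x) (actK A' i x') /\ related (actKV A i x) (actKV A' i x').
Proof.
move=> Ti Rx; split; move: Rx; apply: related_map => s Js.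
  have [-> _] := word_torus q_neq0 modA hwv Js Ti.
  have [-> _] := word_torus q_neq0 modA' hwv' Js Ti.
  exact/relatedZ/related_word.
have [_ ->] := word_torus q_neq0 modA hwv Js Ti.
have [_ ->] := word_torus q_neq0 modA' hwv' Js Ti.
exact/relatedZ/related_word.
Qed.

(** Stability under the E_i needs no more than the highest weight property: the
    commutation relations move E_i to the right through a word, and the scalars
    that appear are the same in V and V'. *)
Lemma relatedE i x x' : inJ m n i -> related x x' -> related (actE A i x) (actE A' i x').
Proof.
move=> Ji; apply: related_map; elim=> [|j s IHs] /= => [_|/andP[Jj Js]].
  by case: hwv => _ -> // _; case: hwv' => _ -> // _; apply: related0.
have EF (W : lmodType k) (B : action W) w : is_module X q m n B ->
    actE B i (actF B j w) = (-1) ^+ (parity m i * parity m j) *: actF B j (actE B i w)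
      + (i == j)%:R *: ((qi q m i - (qi q m i)^-1)^-1 *: (calK X B i w - calKV X B i w)).
  by case=> _ H _ _ _; rewrite -(H i j w Ji Jj); lin_eq k; ring.
rewrite (EF _ _ _ modA) (EF _ _ _ modA').
apply: relatedZD; first by apply: relatedF => //; apply: IHs.
apply/relatedZ/relatedZ.
have [-> ->] := word_ratio q_neq0 modA hwv Js Ji.
have [-> ->] := word_ratio q_neq0 modA' hwv' Js Ji.
rewrite -!scalerBl; exact/relatedZ/related_word.
Qed.

Variables eps eps' : k.
Hypotheses (eps_neq0 : eps != 0) (eps'_neq0 : eps' != 0).
Hypotheses (Sv : actS A v = eps *: v) (Sv' : actS A' v' = eps' *: v').

Lemma word_sigma_eigen (W : lmodType k) (B : action W) w e s : is_module X q m n B ->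
  actS B w = e *: w -> all (inJ m n) s -> actS B (word (actF B) s w) =
    (e * \prod_(j <- s) (-1) ^+ parity m j) *: word (actF B) s w.
Proof.
case=> _ _ _ _ [SS _ SF _] Sw; elim: s => [_|j s IHs /= /andP[Jj Js]].
  by rewrite big_nil mulr1.
have := SF j (actS B (word (actF B) s w)) Jj; rewrite SS => ->.
rewrite (IHs Js) (linE (actF B j)) scalerA big_cons; congr (_ *: _); ring.
Qed.

(** The eigenvalues of sigma on v and v' may differ by a sign, which is absorbed
    by rescaling sigma on one side. *)
Lemma related_sigma x x' : related x x' ->
  related (actS A x) ((eps / eps') *: actS A' x').
Proof.
pose T' : {linear V' -> V'} := (eps / eps') \*: actS A'.
move=> Rx; apply: (related_map (T := actS A) (T' := T')) Rx => s Js.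
rewrite /T' /= (word_sigma_eigen modA Sv Js) (word_sigma_eigen modA' Sv' Js) scalerA.
have -> : eps / eps' * (eps' * \prod_(j <- s) (-1) ^+ parity m j) =
  eps * \prod_(j <- s) (-1) ^+ parity m j by field.
exact/relatedZ/related_word.
Qed.

Lemma domain_submodule : is_submodule X m n A (fun x => exists x', related x x').
Proof.
split.
- split; first by exists 0; apply: related0.
  by move=> a x y [x' Rx] [y' Ry]; exists (a *: x' + y'); apply: relatedZD.
- move=> j x Jj [x' Rx]; split; first by exists (actE A' j x'); apply: relatedE.
  by exists (actF A' j x'); apply: relatedF.
- move=> i x Ti [x' Rx]; have [R1 R2] := related_torus Ti Rx.
  by split; [exists (actK A' i x')|exists (actKV A' i x')].
- by move=> x [x' Rx]; eexists; apply: related_sigma Rx.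
Qed.

Lemma range_submodule : is_submodule X m n A' (fun x' => exists x, related x x').
Proof.
split.
- split; first by exists 0; apply: related0.
  by move=> a x' y' [x Rx] [y Ry]; exists (a *: x + y); apply: relatedZD.
- move=> j x' Jj [x Rx]; split; first by exists (actE A j x); apply: relatedE.
  by exists (actF A j x); apply: relatedF.
- move=> i x' Ti [x Rx]; have [R1 R2] := related_torus Ti Rx.
  by split; [exists (actK A i x)|exists (actKV A i x)].
- move=> x' [x Rx]; exists ((eps / eps')^-1 *: actS A x).
  have ne : eps / eps' != 0 by rewrite mulf_neq0 ?invr_eq0.
  by rewrite -[actS A' x'](scalerK ne); apply/relatedZ/related_sigma.
Qed.

Lemma left_kernel_submodule : is_submodule X m n A (fun x => related x 0).
Proof.
split.
- split; first exact: related0.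
  by move=> a x y Rx Ry; have := relatedZD a Rx Ry; rewrite scaler0 addr0.
- move=> j x Jj Rx; split; first by have := relatedE Jj Rx; rewrite linear0.
  by have := relatedF Jj Rx; rewrite linear0.
- by move=> i x Ti Rx; have := related_torus Ti Rx; rewrite !linear0.
- by move=> x /related_sigma; rewrite linear0 scaler0.
Qed.

Lemma right_kernel_submodule : is_submodule X m n A' (fun x' => related 0 x').
Proof.
split.
- split; first exact: related0.
  by move=> a x y Rx Ry; have := relatedZD a Rx Ry; rewrite scaler0 addr0.
- move=> j x Jj Rx; split; first by have := relatedE Jj Rx; rewrite linear0.
  by have := relatedF Jj Rx; rewrite linear0.
- by move=> i x Ti Rx; have := related_torus Ti Rx; rewrite !linear0.
- move=> x' Rx; have ne : eps / eps' != 0 by rewrite mulf_neq0 ?invr_eq0.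
  have := relatedZ (eps / eps')^-1 (related_sigma Rx).
  by rewrite linear0 scaler0 scalerK.
Qed.

Variable lev : seq nat -> nat.
Hypothesis lev_cat : forall s1 s2, lev (s1 ++ s2) = (lev s1 + lev s2)%N.
Hypothesis lev_gt0 : forall s, all (inJ m n) s -> s != [::] ->
  (forall i, inJ m n i -> ratio_eigen X q m n lam i s = ratio_eigen X q m n lam i [::]) ->
  (0 < lev s)%N.
Hypotheses (nilv : lev_nilpotent m n lev A v) (nilv' : lev_nilpotent m n lev A' v').

(** No pair (v, 0) or (0, v') is related, as the coefficient of the empty word
    can be read off on either side. *)
Lemma related_multiples c c' : related (c *: v) (c' *: v') -> c = c'.
Proof.
move=> [p [Jp E E']].
rewrite -(trivial_comb_fixed q_neq0 lev_cat lev_gt0 modA hwv nilv Jp E).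
exact: (trivial_comb_fixed q_neq0 lev_cat lev_gt0 modA' hwv' nilv' Jp E').
Qed.

(** The kernels of the relation on both sides are proper submodules, hence zero,
    and its domain and range are everything: it is the graph of an isomorphism
    up to the sign of sigma. *)
Lemma simple_has_dim d : is_simple X m n A -> is_simple X m n A' ->
  has_dim (fun _ : V => True) d -> has_dim (fun _ : V' => True) d.
Proof.
move=> simA simA' [b [_ free_b span_b]].
have vn0 : v != 0 by case: hwv.
have v'n0 : v' != 0 by case: hwv'.
have Rv : related v v' by apply: (@related_word [::]).
have dom := simple_generated simA domain_submodule vn0 (ex_intro _ _ Rv).
have ran := simple_generated simA' range_submodule v'n0 (ex_intro (fun x => related x v') _ Rv).
have ker x : related x 0 -> x = 0.
  case: simA => _ /(_ _ left_kernel_submodule)[|/(_ v) R]; first exact.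
  have /eqP : (1 : k) = 0 by apply: related_multiples; rewrite scale1r scale0r.
  by rewrite oner_eq0.
have ker' x' : related 0 x' -> x' = 0.
  case: simA' => _ /(_ _ right_kernel_submodule)[|/(_ v') R]; first exact.
  have /esym/eqP : (0 : k) = 1 by apply: related_multiples; rewrite scale1r scale0r.
  by rewrite oner_eq0.
have [b' Rb] := fin_all_exists (fun i : 'I_d => dom (b i)).
exists b'; split=> // [c S0|x' _].
  by apply: free_b; apply: ker; rewrite -S0; apply: related_sum.
have [x Rx] := ran x'; have [c Ex] := span_b x I; exists c.
apply/eqP; rewrite -subr_eq0; apply/eqP; apply: ker'.
have := relatedZD (-1) (related_sum c Rb) Rx.
by rewrite -Ex !scaleN1r addNr addrC.
Qed.

End Related.

Section SigmaEigenvector.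

Variables (V : lmodType k) (A : action V) (v : V).
Hypothesis modA : is_module X q m n A.

(** One of v + sigma v and v - sigma v is not zero, so a highest weight vector may
    be taken even or odd. *)
Lemma sigma_hwv : (2%:R : k) != 0 -> highest_weight_vector X q m n A lam v ->
  exists (e : k) w, [/\ e != 0, highest_weight_vector X q m n A lam w,
    actS A w = e *: w & w = v + e *: actS A v].
Proof.
move=> two_neq0 [vn0 Ev Kv].
have [_ _ _ _ [SS SE SF SK]] := modA.
have [e [e2 wn0]] : exists e : k, e * e = 1 /\ v + e *: actS A v != 0.
  have [E|ne] := eqVneq (v + 1 *: actS A v) 0; last by exists 1; rewrite mulr1.
  exists (-1); rewrite mulrNN mulr1; split=> //.
  rewrite scaleN1r; apply/eqP => E'; have : 2%:R *: v = (v + 1 *: actS A v) + (v - actS A v).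
    by lin_eq k; ring.
  by rewrite E E' addr0 => /eqP; rewrite scaler_eq0 (negPf two_neq0) (negPf vn0).
have en0 : e != 0 by apply/eqP => e0; move/eqP: e2; rewrite e0 mul0r eq_sym oner_eq0.
exists e, (v + e *: actS A v); split=> //.
- split=> // [j Jj|i Ti].
    rewrite linearD linearZZ Ev // add0r.
    have := SE j v Jj; rewrite Ev // scaler0 => /(congr1 (actS A)).
    by rewrite SS linear0 => ->; rewrite scaler0.
  have := SK i v Ti; rewrite Kv // => /(congr1 (actS A)); rewrite SS => SKv.
  by rewrite linearD (linE (actK A i)) SKv Kv // !(linE (actS A)); lin_eq k; ring.
- by rewrite !(linE (actS A)) SS; rewrite scalerDr scalerA e2 scale1r addrC.
Qed.

Lemma word_sigma_eq0 s w : all (inJ m n) s -> word (actF A) s w = 0 ->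
  word (actF A) s (actS A w) = 0.
Proof.
have [_ _ _ _ [SS SE SF SK]] := modA.
move=> Js Hs; suff [c ->] : exists c : k,
    word (actF A) s (actS A w) = c *: actS A (word (actF A) s w).
  by rewrite Hs linear0 scaler0.
elim: s Js {Hs} => [_|j s IHs /= /andP[Jj Js]]; first by exists 1; rewrite scale1r.
have [c ->] := IHs Js.
have := SF j (word (actF A) s w) Jj => /(congr1 (actS A)); rewrite SS => E.
exists (c * (-1) ^+ parity m j).
by rewrite (linE (actF A j)) E (linE (actS A)) scalerA.
Qed.

Lemma sigma_lev_nilpotent lev e : lev_nilpotent m n lev A v ->
  lev_nilpotent m n lev A (v + e *: actS A v).
Proof.
move=> [N nilN]; exists N => s Js Hs.
rewrite addrC word_linear nilN // addr0 word_sigma_eq0 ?scaler0 //; exact: nilN.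
Qed.

End SigmaEigenvector.

(** The dimension of a simple highest weight module depends only on the weight,
    provided that nonempty words of trivial weight have positive level and words
    of high level annihilate the highest weight vectors.  The level makes up for
    the grading by the root lattice, which the weights do not determine over
    sl(m|m) or at a root of unity. *)
Theorem highest_weight_unique (lev : seq nat -> nat) (V V' : lmodType k)
    (A : action V) (A' : action V') v v' d :
  (2%:R : k) != 0 ->
  (forall s1 s2, lev (s1 ++ s2) = (lev s1 + lev s2)%N) ->
  (forall s, all (inJ m n) s -> s != [::] ->
    (forall i, inJ m n i -> ratio_eigen X q m n lam i s = ratio_eigen X q m n lam i [::]) ->
    (0 < lev s)%N) ->
  is_module X q m n A -> is_simple X m n A ->
  highest_weight_vector X q m n A lam v -> lev_nilpotent m n lev A v ->
  is_module X q m n A' -> is_simple X m n A' ->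
  highest_weight_vector X q m n A' lam v' -> lev_nilpotent m n lev A' v' ->
  has_dim (fun _ : V => True) d -> has_dim (fun _ : V' => True) d.
Proof.
move=> two_neq0 lev_cat lev_gt0 modA simA hw nil modA' simA' hw' nil'.
have [e [w [en0 hww Sw Ew]]] := sigma_hwv modA two_neq0 hw.
have [e' [w' [en0' hww' Sw' Ew']]] := sigma_hwv modA' two_neq0 hw'.
have nilw : lev_nilpotent m n lev A w by rewrite Ew; apply: sigma_lev_nilpotent.
have nilw' : lev_nilpotent m n lev A' w' by rewrite Ew'; apply: sigma_lev_nilpotent.
exact: (simple_has_dim modA hww modA' hww' en0 en0' Sw Sw' lev_cat lev_gt0).
Qed.

End Uniqueness.

(** * Weights for q not a root of unity *)

Section GenericWeights.

Variables (X : version) (k : fieldType) (q : k) (m n : nat).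
Hypotheses (q_neq0 : q != 0) (q_generic : qchar_is q 0) (m_gt0 : (0 < m)%N).

Lemma generic_expfz_eq1 (z : int) : q ^ z = 1 -> z = 0.
Proof.
have main i : (0 < i)%N -> q ^+ i <> 1.
  move=> i_gt0 E; have := q_generic i_gt0.
  by rewrite /qint E invr1 subrr mul0r eqxx.
case: z => [[|i]|i] //; first by rewrite -exprnP => /(main _ (ltn0Sn _)).
by rewrite NegzE -exprnN => /(congr1 GRing.inv); rewrite invrK invr1 => /(main _ (ltn0Sn _)).
Qed.

(** A sequence without second differences that vanishes at two places is zero. *)
Lemma arithmetic_eq0 (b : nat -> nat) (p : nat) : b 0 = 0%N -> b p = 0%N ->
  (forall i, (0 < i < p)%N -> b i.-1 + b i.+1 = (b i).*2)%N ->
  forall i, (i <= p)%N -> b i = 0%N.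
Proof.
move=> b0 bp H.
have lin i : ((i <= p)%N -> b i = i * b 1)%N /\ ((i.+1 <= p)%N -> b i.+1 = i.+1 * b 1)%N.
  elim: i => [|i [IH1 IH2]]; first by rewrite b0 mul0n mul1n.
  split=> // lt; have := H i.+1; rewrite /= IH1 ?IH2; lia.
move=> i le_ip; have [|p_gt0] := posnP p; first by move=> p0; have -> : i = 0%N by lia.
have [H1 _] := lin p; have [H2 _] := lin i.
rewrite H2 //; move: (H1 (leqnn p)); rewrite bp => /esym/eqP; rewrite muln_eq0.
by case/orP => /eqP; [lia|move=> ->; rewrite muln0].
Qed.

(** The symmetrised Cartan matrix (alpha_i, alpha_j) of gl(m|n). *)
Definition cartan (i j : nat) : int :=
  (if (i <= m)%N then 1 else -1) * ((i == j)%:Z - (i == j.+1)%:Z)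
  - (if (i < m)%N then 1 else -1) * ((i.+1 == j)%:Z - (i.+1 == j.+1)%:Z).

Lemma Kchar_exp i j :
  Kchar q m i j = q ^ ((if (i <= m)%N then 1 else -1) * ((i == j)%:Z - (i == j.+1)%:Z)).
Proof.
rewrite /Kchar /qi; case: ifP => _; first by rewrite mul1r.
by rewrite mulN1r -exprz_inv.
Qed.

Lemma ratio_char i j : Kchar q m i j / Kchar q m i.+1 j = q ^ cartan i j.
Proof. by rewrite !Kchar_exp /cartan expfzDr // -invr_expz. Qed.

Lemma prod_expfz (s : seq nat) (f : nat -> int) :
  \prod_(j <- s) (q ^ f j)^-1 = (q ^ (\sum_(j <- s) f j))^-1.
Proof.
elim: s => [|j s IHs]; first by rewrite !big_nil expr0z invr1.
by rewrite !big_cons IHs expfzDr // invfM.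
Qed.

Lemma ratio_eigen_trivial lam i s :
  ratio_eigen X q m n lam i s = ratio_eigen X q m n lam i [::] ->
  \sum_(j <- s) cartan i j = 0.
Proof.
have neq0 Y i' s' : torus_eigen Y q m n lam i' s' != 0 by apply: torus_eigen_neq0.
have eqE Y : torus_eigen Y q m n lam i s =
  (\prod_(j <- s) (torus_char Y q m i j)^-1) * torus_eigen Y q m n lam i [::].
  by rewrite /torus_eigen big_nil mul1r.
suff E : ratio_eigen X q m n lam i s =
    (q ^ (\sum_(j <- s) cartan i j))^-1 * ratio_eigen X q m n lam i [::].
  have nz : ratio_eigen X q m n lam i [::] != 0.
    by rewrite /ratio_eigen; case: X => //; rewrite mulf_neq0 ?invr_eq0.
  rewrite E => H; apply: generic_expfz_eq1; apply: invr_inj; rewrite invr1.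
  by apply: (mulIf nz); rewrite H mul1r.
rewrite -prod_expfz /ratio_eigen; case: X; last first.
  rewrite /torus_eigen big_nil mul1r; congr (_ * _).
  by apply: eq_bigr => j _; rewrite -ratio_char.
rewrite /torus_eigen !big_nil !mul1r invfM mulrACA; congr (_ * _).
rewrite -prodfV -big_split; apply: eq_bigr => j _ /=.
by rewrite -ratio_char invf_div invrK mulrC.
Qed.

(** For q not a root of unity a word of trivial weight has content orthogonal to
    all simple roots.  Away from m this says that the multiplicities form two
    arithmetic progressions, vanishing at 0 and at m + n respectively; if F_m
    did not occur both would vanish at m too. *)
Lemma generic_trivial_word lam s : all (inJ m n) s -> s != [::] ->
  (forall i, inJ m n i -> ratio_eigen X q m n lam i s = ratio_eigen X q m n lam i [::]) ->
  (0 < count_mem m s)%N.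
Proof.
move=> Js s_neq0 H; rewrite lt0n; apply: contra s_neq0 => /eqP bm.
pose b i := count_mem i s.
have count_sum i : (b i)%:Z = \sum_(j <- s) (i == j)%:Z.
  rewrite /b; elim: s {H bm Js b} => [|j s IHs]; first by rewrite big_nil.
  by rewrite big_cons /= PoszD IHs eq_sym.
have bJ i : ~~ inJ m n i -> b i = 0%N.
  by move=> nJ; apply/count_memPn; apply: contra nJ; apply: (allP Js).
have rec i : inJ m n i -> i != m -> (b i.-1 + b i.+1 = (b i).*2)%N.
  move=> Ji ne; have := ratio_eigen_trivial (H i Ji); rewrite /cartan.
  have -> : (i <= m)%N = (i < m)%N by lia.
  have i_gt0 : (0 < i)%N by move: Ji; rewrite /inJ; lia.
  set c : int := if _ then _ else _.
  have -> : \sum_(j <- s) (c * ((i == j)%:Z - (i == j.+1)%:Z) - c * ((i.+1 == j)%:Z - (i.+1 == j.+1)%:Z))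
     = c * ((b i)%:Z *+ 2 - (b i.-1)%:Z - (b i.+1)%:Z).
    rewrite !count_sum -sumrMnl -!sumrB mulr_sumr; apply: eq_bigr => j _.
    have -> : (i == j.+1) = (i.-1 == j) by lia.
    by rewrite eqSS; ring.
  move/eqP; rewrite mulf_eq0 => /orP[|/eqP]; first by rewrite /c; case: ifP.
  lia.
have left i : (i <= m)%N -> b i = 0%N.
  apply: arithmetic_eq0 => //; first by apply: bJ; rewrite /inJ.
  by move=> j Hj; apply: rec; rewrite /inJ; lia.
have right i : (i <= n)%N -> b (m + n - i)%N = 0%N.
  apply: (@arithmetic_eq0 (fun i => b (m + n - i)%N)).
  - by apply: bJ; rewrite /inJ; lia.
  - by rewrite addnK.
  - move=> j Hj; rewrite -rec; [|by rewrite /inJ; lia|lia].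
    by rewrite addnC; congr (b _ + b _)%N; lia.
rewrite -size_eq0 -leqn0 leqNgt -has_predT; apply/hasPn => i si /=.
have /(allP Js) := si; rewrite /inJ => Ji.
have : b i = 0%N.
  have [/left//|gt] := leqP i m.
  have -> : i = (m + n - (m + n - i))%N by lia.
  by apply: right; lia.
by move/count_memPn; rewrite si.
Qed.

Lemma generic_lev_nilpotent (V : lmodType k) (A : action V) v :
  is_module X q m n A -> lev_nilpotent m n (count_mem m) A v.
Proof.
move=> [_ _ _ serreF _].
have q2 : q ^+ 2 + 1 != 0.
  have := q_generic (isT : 0 < 2)%N; rewrite /qint; apply: contra => /eqP E.
  have q21 : q ^+ 2 = -1 by apply/eqP; rewrite -subr_eq0 opprK E.
  by rewrite q21 invrN1 subrr mul0r.
by have [N H] := odd_words_nilpotent q_neq0 q2 m_gt0 serreF; exists N => s; apply: H.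
Qed.

End GenericWeights.

(** * The module on the Grassmann superalgebra *)

Section Fock.

Variables (k : fieldType) (q : k) (m n t l : nat).
Hypotheses (q_neq0 : q != 0) (q2_neq1 : q ^+ 2 != 1).
Hypotheses (l_char : qchar_is q l) (l_range : l = 0%N \/ (2 < l)%N).

(** The largest value of an even occupation number; in the generic case the
    degree t bounds it anyway. *)
Definition cap : nat := if l == 0%N then t else l.-1.

Definition occupation := ({ffun 'I_m -> 'I_cap.+1} * {ffun 'I_n -> bool})%type.

Definition occ_degree (b : occupation) : nat := (\sum_i b.1 i + \sum_i b.2 i)%N.

(** The basis vectors of degree t of the Grassmann superalgebra. *)
Definition state := {b : occupation | occ_degree b == t}.

(** The occupation numbers at the positions 1, ..., m + n, with values in the
    integers so that moving a unit can be written without side conditions. *)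
Definition occ (b : state) (x : nat) : int :=
  if x is x'.+1 then
    if insub x' : option 'I_m is Some i then ((val b).1 i)%:Z
    else if insub (x' - m)%N : option 'I_n is Some i then ((val b).2 i)%:Z else 0
  else 0.
#[local] Arguments occ : simpl never.

Lemma occ_even b (i : 'I_m) : occ b i.+1 = ((val b).1 i)%:Z.
Proof. by rewrite /occ valK. Qed.

Lemma occ_odd b (i : 'I_n) : occ b (m + i).+1 = ((val b).2 i)%:Z.
Proof. by rewrite /occ insubF ?addKn ?valK // ltnNge leq_addr. Qed.

Definition inI (x : nat) : bool := (0 < x <= m + n)%N.

Lemma inIP x : inI x -> (exists i : 'I_m, x = i.+1) \/ (exists i : 'I_n, x = (m + i).+1).
Proof.
move=> /andP[x_gt0 x_le]; have [lt|ge] := ltnP x.-1 m.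
  by left; exists (Ordinal lt); rewrite /= prednK.
have lt : (x.-1 - m < n)%N by lia.
by right; exists (Ordinal lt); rewrite /=; lia.
Qed.

Definition admissible (x : nat) (a : int) : bool :=
  (0 <= a) && (if (x <= m)%N then (l == 0%N) || (a < l%:Z) else (a <= 1)).

Lemma occ_sum b : \sum_(1 <= x < (m + n).+1) occ b x = t%:Z.
Proof.
transitivity ((occ_degree (val b))%:Z); last by rewrite (eqP (valP b)).
rewrite big_add1 /= /occ_degree PoszD.
rewrite (big_cat_nat (n := m)) ?leq_addr //=; congr (_ + _).
  rewrite big_mkord -[RHS]natz natr_sum.
  by apply: eq_bigr => i _; rewrite occ_even natz.
rewrite -[X in index_iota X _]add0n big_addn addKn big_mkord -[RHS]natz natr_sum.
by apply: eq_bigr => i _; rewrite addnC occ_odd natz.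
Qed.

Lemma occ_admissible b x : inI x -> admissible x (occ b x).
Proof.
move=> /inIP[[i ->]|[i ->]].
  rewrite occ_even /admissible le0z_nat ltn_ord /= ltz_nat.
  have cap_lt c : (c < cap.+1)%N -> (l == 0%N) || (c < l)%N.
    by rewrite /cap; case: eqP => //= l0; lia.
  exact: cap_lt (ltn_ord _).
rewrite occ_odd /admissible le0z_nat ltnNge leq_addr /=.
by case: ((val b).2 i).
Qed.

Lemma state_exists (a : nat -> int) : (forall x, inI x -> admissible x (a x)) ->
  \sum_(1 <= x < (m + n).+1) a x = t%:Z ->
  exists b, forall x, inI x -> occ b x = a x.
Proof.
move=> adm_a sum_a.
have ge0 x : inI x -> 0 <= a x by move/adm_a => /andP[].
have cap_a (i : 'I_m) : (`|a i.+1| < cap.+1)%N.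
  have Ni : inI i.+1 by rewrite /inI; have := ltn_ord i; lia.
  rewrite /cap; case: eqP => [_|l_neq0]; last first.
    have := adm_a _ Ni; rewrite /admissible ltn_ord; case: eqP => //= _; lia.
  suff : a i.+1 <= t%:Z by have := ge0 _ Ni; lia.
  rewrite -sum_a (bigD1_seq i.+1) ?iota_uniq //=; last by rewrite mem_index_iota; move: Ni; rewrite /inI; lia.
  rewrite lerDl big_seq_cond; apply: sumr_ge0 => x; rewrite mem_index_iota => /andP[Nx _].
  by apply: ge0; rewrite /inI; lia.
pose b0 : occupation := ([ffun i => Ordinal (cap_a i)], [ffun i : 'I_n => a (m + i).+1 == 1]).
have E1 (i : 'I_m) : (b0.1 i)%:Z = a i.+1.
  by rewrite ffunE /= gez0_abs // ge0 // /inI; have := ltn_ord i; lia.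
have E2 (i : 'I_n) : (b0.2 i)%:Z = a (m + i).+1.
  have Ni : inI (m + i).+1 by rewrite /inI; have := ltn_ord i; lia.
  have := adm_a _ Ni; rewrite /admissible ffunE ltnNge leq_addr /=; case: eqP => [->//|ne /andP[? ?]].
  by rewrite /=; lia.
have deg0 : occ_degree b0 == t.
  rewrite -eqz_nat -sum_a /occ_degree PoszD big_add1 /=.
  rewrite (big_cat_nat (n := m)) ?leq_addr //=; apply/eqP; congr (_ + _).
    rewrite big_mkord -[LHS]natz natr_sum.
    by apply: eq_bigr => i _; rewrite natz E1.
  rewrite -[X in index_iota X _]add0n big_addn addKn big_mkord -[LHS]natz natr_sum.
  by apply: eq_bigr => i _; rewrite natz E2 addnC.
exists (exist _ b0 deg0) => x /inIP[[i ->]|[i ->]]; first by rewrite occ_even E1.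
by rewrite occ_odd E2.
Qed.

Lemma occ_inj b b' : (forall x, inI x -> occ b x = occ b' x) -> b = b'.
Proof.
move=> E; apply: val_inj; case: b b' E => [[b1 b2] ?] [[c1 c2] ?] /= E.
congr (_, _); apply/ffunP => i.
  have := E i.+1; rewrite !occ_even /= => H; apply: val_inj; apply/eqP.
  by rewrite -eqz_nat H // /inI; have := ltn_ord i; lia.
have := E (m + i).+1; rewrite !occ_odd /= => H.
have : ((b2 i : nat) == (c2 i : nat)) by rewrite -eqz_nat H // /inI; have := ltn_ord i; lia.
by case: (b2 i); case: (c2 i).
Qed.

Local Notation fock := {ffun state -> k^o}.

(** The coefficient of f at the occupation numbers a, read as zero when a is not
    the sequence of occupation numbers of a state. *)
Definition coef_at (f : fock) (a : nat -> int) : k :=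
  if [pick b : state | [forall x : 'I_(m + n), occ b x.+1 == a x.+1]] is Some b
  then f b else 0.

Lemma coef_at_spec f a :
  (exists b, (forall x, inI x -> occ b x = a x) /\ coef_at f a = f b) \/
  ((forall b, ~ forall x, inI x -> occ b x = a x) /\ coef_at f a = 0).
Proof.
rewrite /coef_at; case: pickP => [b /forallP H|H]; [left|right].
  exists b; split=> // x /andP[x0 xN].
  have lt : (x.-1 < m + n)%N by lia.
  by have /eqP := H (Ordinal lt); rewrite /= prednK.
split=> // b Hb; have /negP := negbT (H b); apply; apply/forallP => x.
by apply/eqP/Hb; rewrite /inI; have := ltn_ord x; lia.
Qed.

Lemma coef_at_occ f b a : (forall x, inI x -> occ b x = a x) -> coef_at f a = f b.
Proof.
move=> H; have [[b' [Hb' ->]]|[/(_ b)//]] := coef_at_spec f a.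
by congr (f _); apply: occ_inj => x Nx; rewrite H ?Hb'.
Qed.

Lemma coef_at_eq f a a' : (forall x, inI x -> a x = a' x) -> coef_at f a = coef_at f a'.
Proof.
move=> E; have [[b [Hb ->]]|[no ->]] := coef_at_spec f a.
  by rewrite (@coef_at_occ f b) // => x Nx; rewrite -E ?Hb.
have [[b [Hb _]]|[_ ->//]] := coef_at_spec f a'.
by case: (no b) => x Nx; rewrite Hb ?E.
Qed.

Lemma coef_at_eq0 f a x : inI x -> ~~ admissible x (a x) -> coef_at f a = 0.
Proof.
move=> Nx na; have [[b [Hb _]]|[_ //]] := coef_at_spec f a.
by have := occ_admissible b Nx; rewrite Hb // (negPf na).
Qed.

Lemma coef_at_linear a c (f g : fock) : coef_at (c *: f + g) a = c * coef_at f a + coef_at g a.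
Proof. by rewrite /coef_at; case: pickP => [b _|_]; rewrite ?mulr0 ?addr0 // !ffunE. Qed.

Definition qnum (a : int) : k := (q ^ a - q ^ (- a)) / (q - q^-1).

Lemma q_qV_neq0 : q - q^-1 != 0.
Proof.
apply: contra q2_neq1; rewrite subr_eq0 => /eqP E.
by rewrite expr2 {2}E mulfV.
Qed.

(** The coefficient of the divided power basis vector that gained its a-th unit
    at position x. *)
Definition phi (x : nat) (a : int) : k := if (x <= m)%N then qnum a else (a == 1)%:R.

Lemma phi0 x : phi x 0 = 0.
Proof. by rewrite /phi /qnum oppr0 subrr mul0r if_same. Qed.

Lemma qnum_nat j : qnum j%:Z = qint q j.
Proof. by rewrite /qnum /qint -exprnN. Qed.

(** The coefficient vanishes when the last admissible value is exceeded, which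
    is why the restricted algebra is closed under the action. *)
Lemma phi_top x a : admissible x a -> ~~ admissible x (a + 1) -> phi x (a + 1) = 0.
Proof.
rewrite /admissible /phi => /andP[a_ge0]; have -> /= : 0 <= a + 1 by lia.
case: leqP => _; last by case: eqP => //; lia.
case: eqP => //= l0 lt ge; have -> : a + 1 = l%:Z by lia.
by rewrite qnum_nat; case: l l0 l_char => // l' _ [].
Qed.

Lemma phi_neq0 x a : admissible x a -> a != 0 -> phi x a != 0.
Proof.
rewrite /admissible /phi => /andP[a_ge0]; case: leqP => _; last first.
  move=> a1 ne; suff -> : a = 1 by rewrite eqxx oner_eq0.
  by lia.
case: a a_ge0 => // a _; rewrite eqz_nat -lt0n ltz_nat qnum_nat => H a_gt0.
by move: l_char H; case: l => [|l'] /=; [move=> H _; apply: H|move=> [_ H] lt; apply: H; rewrite a_gt0].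
Qed.

Definition upd (a : nat -> int) (x y z : nat) : int :=
  a z + (z == y)%:Z - (z == x)%:Z.

(** The operator that sends a unit from position y to position x, on coefficient
    functions: the value at b is read at the state in which the unit is still at
    position y. *)
Definition move_fun (x y : nat) (f : fock) : fock :=
  [ffun b => phi x (occ b x) * coef_at f (upd (occ b) x y)].

Lemma move_is_linear x y : linear (move_fun x y).
Proof.
move=> c f g; apply/ffunP => b; rewrite !ffunE coef_at_linear.
by rewrite /GRing.scale /=; ring.
Qed.

HB.instance Definition _ x y :=
  GRing.isLinear.Build k fock fock _ (move_fun x y) (move_is_linear x y).

Definition move x y : {linear fock -> fock} := move_fun x y.

Definition nonneg (a : nat -> int) := forall z, inI z -> 0 <= a z.

Lemma sum_delta y : inI y -> \sum_(1 <= z < (m + n).+1) (z == y)%:Z = 1 :> int.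
Proof.
move=> Ny; rewrite (bigD1_seq y) ?iota_uniq //=; last by rewrite mem_index_iota; move: Ny; rewrite /inI; lia.
by rewrite eqxx big1 ?addr0 // => z /negPf ->.
Qed.

Lemma upd_sum a x y : inI x -> inI y ->
  \sum_(1 <= z < (m + n).+1) upd a x y z = \sum_(1 <= z < (m + n).+1) a z.
Proof.
by move=> Nx Ny; rewrite sumrB big_split /= !sum_delta // addrK.
Qed.

(** The defining formula of move holds at every nonnegative a and not only at
    states: when a is not admissible at x but becomes so after the move, the
    coefficient is zero. *)
Lemma coef_at_move f a x y : nonneg a -> inI x -> inI y -> x != y ->
  coef_at (move x y f) a = phi x (a x) * coef_at f (upd a x y).
Proof.
move=> a_ge0 Nx Ny ne; have [[b [Hb ->]]|[no ->]] := coef_at_spec (move x y f) a.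
  rewrite ffunE Hb //; congr (_ * _); apply: coef_at_eq => z Nz.
  by rewrite /upd Hb.
have [[b [Hb _]]|[_ ->]] := coef_at_spec f (upd a x y); last by rewrite mulr0.
have [adm|nadm] := boolP (admissible x (a x)).
  have sum_a : \sum_(1 <= z < (m + n).+1) a z = t%:Z.
    rewrite -(upd_sum a Nx Ny) -(occ_sum b) !big_seq; apply: eq_bigr => z.
    by rewrite mem_index_iota => Nz; rewrite Hb // /inI; lia.
  have [z Nz|b' /no//] := state_exists _ sum_a.
  have [->//|nzx] := eqVneq z x.
  have := occ_admissible b Nz; rewrite Hb // /upd (negPf nzx) subr0.
  have := a_ge0 _ Nz; rewrite /admissible => -> /= /andP[_].
  by case: ifP => _; [case: (l == 0%N) => //=|]; case: (z == y) => /=; lia.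
have adm' := occ_admissible b Nx; rewrite Hb // /upd eqxx (negPf ne) addr0 in adm'.
by have := phi_top adm'; rewrite subrK => -> //; rewrite mul0r.
Qed.

Lemma upd_nonneg a x y : nonneg a -> a x != 0 -> nonneg (upd a x y).
Proof.
move=> a_ge0 ax z Nz; rewrite /upd; have := a_ge0 z Nz.
by have [E|_] := eqVneq z x; [rewrite -E in ax|]; case: (z == y) => /=; lia.
Qed.

Lemma nonneg_occ b : nonneg (occ b).
Proof. by move=> z Nz; have /andP[] := occ_admissible b Nz. Qed.

Definition run (w : seq (nat * nat)) (f : fock) : fock :=
  foldr (fun xy g => move xy.1 xy.2 g) f w.

Fixpoint run_coef (w : seq (nat * nat)) (a : nat -> int) : k :=
  if w is xy :: w' then phi xy.1 (a xy.1) * run_coef w' (upd a xy.1 xy.2) else 1.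

Fixpoint run_state (w : seq (nat * nat)) (a : nat -> int) : nat -> int :=
  if w is xy :: w' then run_state w' (upd a xy.1 xy.2) else a.

Definition good_moves (w : seq (nat * nat)) : bool :=
  all (fun xy => [&& inI xy.1, inI xy.2 & xy.1 != xy.2]) w.

Lemma coef_at_run w f a : nonneg a -> good_moves w ->
  coef_at (run w f) a = run_coef w a * coef_at f (run_state w a).
Proof.
elim: w a => [|[x y] w IHw] a a_ge0 /=; first by rewrite mul1r.
move=> /andP[/and3P[Nx Ny ne] gw]; rewrite coef_at_move //.
have [ax0|ax] := eqVneq (a x) 0; first by rewrite ax0 phi0 !mul0r.
by rewrite IHw ?mulrA //; apply: upd_nonneg.
Qed.

(** A product of moves is evaluated by following the occupation numbers, without
    asking whether they stay admissible.  All relations of the module are thereby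
    reduced to identities between the coefficients. *)
Lemma run_at w f b : good_moves w ->
  run w f b = run_coef w (occ b) * coef_at f (run_state w (occ b)).
Proof. by move=> gw; rewrite -coef_at_run ?(@coef_at_occ _ b) //; apply: nonneg_occ. Qed.

Lemma q2V_neq1 : q * q - 1 != 0.
Proof. by rewrite -expr2 subr_eq0. Qed.

Lemma qnum_rec a : qnum (a + 1) - (q + q^-1) * qnum a + qnum (a - 1) = 0.
Proof.
have u : q ^ a != 0 by rewrite expfz_neq0.
have := q2V_neq1.
rewrite /qnum !opprD !opprK !expfzDr // -!invr_expz expr1z => H.
by field; rewrite u q_neq0 H.
Qed.

Lemma qnumB a b : qnum a * qnum (b + 1) - qnum b * qnum (a + 1) = qnum (a - b).
Proof.
have u : q ^ a != 0 by rewrite expfz_neq0.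
have v : q ^ b != 0 by rewrite expfz_neq0.
have := q2V_neq1.
rewrite /qnum !opprD !opprK !expfzDr // -!invr_expz expr1z => H.
by field; rewrite u v q_neq0 H.
Qed.

Ltac decide_eqs :=
  repeat match goal with
  | |- context [@eq_op _ ?a ?b] =>
    first [ rewrite (_ : (@eq_op nat a b) = true); last lia
          | rewrite (_ : (@eq_op nat a b) = false); last lia ]
  end.

Lemma moveC x y u v f : inI x -> inI y -> x != y -> inI u -> inI v -> u != v ->
  x != v -> u != y -> move x y (move u v f) = move u v (move x y f).
Proof.
move=> Nx Ny xy Nu Nv uv xv uy; apply/ffunP => b.
have gm : good_moves [:: (x, y); (u, v)] by rewrite /= Nx Ny Nu Nv xy uv.
have gm' : good_moves [:: (u, v); (x, y)] by rewrite /= Nx Ny Nu Nv xy uv.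
rewrite -[LHS]/(run [:: (x, y); (u, v)] f b) -[RHS]/(run [:: (u, v); (x, y)] f b).
rewrite !run_at //= (@coef_at_eq f (upd (upd (occ b) u v) x y) (upd (upd (occ b) x y) u v)).
  congr (_ * _); rewrite /upd (negPf xv) (negPf uy) [x == u]eq_sym.
  by have [->|ne] := eqVneq u x; rewrite /= ?subr0 ?addr0; ring.
by move=> z _; rewrite /upd; ring.
Qed.

Lemma serre_at (f g h : fock) c b : (f - c *: g + h) b = f b - c * g b + h b.
Proof. by rewrite !ffunE. Qed.

Lemma run2 A x1 y1 x2 y2 f b : good_moves [:: (x1, y1); (x2, y2)] ->
  (forall z, upd (upd (occ b) x1 y1) x2 y2 z = A z) ->
  move x1 y1 (move x2 y2 f) b =
    phi x1 (occ b x1) * phi x2 (upd (occ b) x1 y1 x2) * coef_at f A.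
Proof.
move=> gm EA; have := run_at f b gm => /= ->; rewrite mulr1.
by congr (_ * _); apply: coef_at_eq => z _; apply: EA.
Qed.

Lemma run3 A x1 y1 x2 y2 x3 y3 f b : good_moves [:: (x1, y1); (x2, y2); (x3, y3)] ->
  (forall z, upd (upd (upd (occ b) x1 y1) x2 y2) x3 y3 z = A z) ->
  move x1 y1 (move x2 y2 (move x3 y3 f)) b =
    phi x1 (occ b x1) * phi x2 (upd (occ b) x1 y1 x2)
    * phi x3 (upd (upd (occ b) x1 y1) x2 y2 x3) * coef_at f A.
Proof.
move=> gm EA; have := run_at f b gm => /= ->; rewrite mulr1 !mulrA.
by congr (_ * _); apply: coef_at_eq => z _; apply: EA.
Qed.

Lemma run4 A x1 y1 x2 y2 x3 y3 x4 y4 f b :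
  good_moves [:: (x1, y1); (x2, y2); (x3, y3); (x4, y4)] ->
  (forall z, upd (upd (upd (upd (occ b) x1 y1) x2 y2) x3 y3) x4 y4 z = A z) ->
  move x1 y1 (move x2 y2 (move x3 y3 (move x4 y4 f))) b =
    phi x1 (occ b x1) * phi x2 (upd (occ b) x1 y1 x2)
    * phi x3 (upd (upd (occ b) x1 y1) x2 y2 x3)
    * phi x4 (upd (upd (upd (occ b) x1 y1) x2 y2) x3 y3 x4) * coef_at f A.
Proof.
move=> gm EA; have := run_at f b gm => /= ->; rewrite mulr1 !mulrA.
by congr (_ * _); apply: coef_at_eq => z _; apply: EA.
Qed.

Ltac moves_good := rewrite /good_moves /inI /=; lia.
Ltac moves_end a := move=> z; rewrite /a /upd; ring.

Lemma phi_rec x a : (x <= m)%N -> phi x (a + 1) - (q + q^-1) * phi x a + phi x (a - 1) = 0.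
Proof. by rewrite /phi => ->; apply: qnum_rec. Qed.

Lemma phi_phiB1 x a : (m < x)%N -> phi x a * phi x (a - 1) = 0.
Proof.
rewrite /phi ltnNge => /negPf ->.
by have [->|ne] := eqVneq a 1; rewrite ?mul0r // mul1r.
Qed.

(** The cubic relation when the second operator feeds the source y of the first:
    the three coefficients at y are consecutive quantum integers, unless x is odd
    and cannot be raised twice. *)
Lemma serre_source x y v f : inI x -> inI y -> inI v -> x != y -> y != v -> x != v ->
  (m < x)%N || (y <= m)%N ->
  move x y (move x y (move y v f)) - (q + q^-1) *: move x y (move y v (move x y f))
    + move y v (move x y (move x y f)) = 0.
Proof.
rewrite /inI => Nx Ny Nv xy yv xv bos; apply/ffunP => b; rewrite serre_at [RHS]ffunE.
pose a := upd (upd (upd (occ b) x y) x y) y v.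
rewrite !(@run3 a); try (by moves_good); try (by moves_end a).
rewrite /upd; decide_eqs; rewrite /= ?addr0 ?subr0.
move: (coef_at f a) (occ b x) (occ b y) => e X Y.
case/orP: bos => [/phi_phiB1|] H.
  transitivity ((phi x X * phi x (X - 1)) *
    ((phi y (Y + 1 + 1) - (q + q^-1) * phi y (Y + 1) + phi y Y) * e)); first by ring.
  by rewrite H mul0r.
transitivity ((phi x X * phi x (X - 1)) * e *
    (phi y (Y + 1 + 1) - (q + q^-1) * phi y (Y + 1) + phi y (Y + 1 - 1))).
  by rewrite addrK; ring.
by rewrite phi_rec // mulr0.
Qed.

(** The cubic relation when the second operator takes from the target x of the
    first: now the coefficients at x are consecutive, unless y is odd and cannot
    supply two units. *)
Lemma serre_target x y u f : inI x -> inI y -> inI u -> x != y -> u != x -> y != u ->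
  (x <= m)%N || (m < y)%N ->
  move x y (move x y (move u x f)) - (q + q^-1) *: move x y (move u x (move x y f))
    + move u x (move x y (move x y f)) = 0.
Proof.
rewrite /inI => Nx Ny Nu xy ux yu bos; apply/ffunP => b; rewrite serre_at [RHS]ffunE.
pose a := upd (upd (upd (occ b) x y) x y) u x.
rewrite !(@run3 a); try (by moves_good); try (by moves_end a).
rewrite /upd; decide_eqs; rewrite /= ?addr0 ?subr0 ?subrK ?addrK.
case/orP: bos => H.
  transitivity ((phi u (occ b u) * phi x (occ b x)) * coef_at f a *
    (phi x (occ b x + 1) - (q + q^-1) * phi x (occ b x) + phi x (occ b x - 1))); first by ring.
  by rewrite phi_rec // mulr0.
rewrite (@coef_at_eq0 f a y) ?mulr0 ?subr0 ?addr0 //.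
have := nonneg_occ b Ny; rewrite /a /upd; decide_eqs.
rewrite /admissible leqNgt H /=; lia.
Qed.

Lemma move_sqr0 x y f : inI x -> inI y -> x != y -> (m < x)%N || (m < y)%N ->
  move x y (move x y f) = 0.
Proof.
rewrite /inI => Nx Ny xy odd; apply/ffunP => b; rewrite [RHS]ffunE.
pose a := upd (upd (occ b) x y) x y.
rewrite (@run2 a); try (by moves_good); try (by moves_end a).
rewrite {1}/upd; decide_eqs; rewrite /= ?addr0.
case/orP: odd => H; first by rewrite phi_phiB1 ?mul0r.
rewrite (@coef_at_eq0 f a y) ?mulr0 ?subr0 ?addr0 //.
have := nonneg_occ b Ny; rewrite /a /upd; decide_eqs.
rewrite /admissible leqNgt H /=; lia.
Qed.

Lemma quartic_at (f1 f2 f3 f4 f5 : fock) c b :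
  (f1 + f2 + f3 + f4 - c *: f5) b = f1 b + f2 b + f3 b + f4 b - c * f5 b.
Proof. by rewrite !ffunE. Qed.

Lemma phi_odd x a : (m < x)%N -> phi x a = (a == 1)%:R.
Proof. by rewrite /phi ltnNge => /negPf ->. Qed.

Lemma occ_odd01 b x : inI x -> (m < x)%N -> occ b x = 0 \/ occ b x = 1.
Proof.
move=> Nx lt; have := occ_admissible b Nx; rewrite /admissible leqNgt lt /=; lia.
Qed.

(** When position m + 1 is empty at the end, the five coefficients reduce to
    three consecutive quantum integers at position m; otherwise all terms start
    from a state with two units there. *)
Lemma quartic_E f : inI m.-1 -> inI m.+2 ->
  let E j := move j j.+1 in
  E m.-1 (E m (E m.+1 (E m f))) + E m (E m.-1 (E m (E m.+1 f)))
  + E m.+1 (E m (E m.-1 (E m f))) + E m (E m.+1 (E m (E m.-1 f)))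
  - (q + q^-1) *: E m (E m.-1 (E m.+1 (E m f))) = 0.
Proof.
rewrite /inI => Nx Ny /=; have -> : m.-1.+1 = m by lia.
apply/ffunP => b; rewrite quartic_at [RHS]ffunE.
pose a := upd (upd (upd (upd (occ b) m.-1 m) m m.+1) m.+1 m.+2) m m.+1.
rewrite !(@run4 a); try (by moves_good); try (by moves_end a).
rewrite /upd; decide_eqs; rewrite /= ?addr0 ?subr0 ?subrK ?addrK.
have Nm1 : inI m.+1 by rewrite /inI; lia.
have [E|E] := occ_odd01 b Nm1 (ltnSn m).
  rewrite E !(phi_odd _ (ltnSn m)) /= ?add0r ?eqxx.
  transitivity (phi m.-1 (occ b m.-1) * phi m (occ b m) * coef_at f a *
   (phi m (occ b m + 1) - (q + q^-1) * phi m (occ b m) + phi m (occ b m - 1))); first by ring.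
  by rewrite phi_rec // mulr0.
rewrite (@coef_at_eq0 f a m.+1) ?mulr0 ?subr0 ?addr0 //.
rewrite /a /upd; decide_eqs; rewrite E /admissible ltnn /=; lia.
Qed.

Lemma quartic_F f : inI m.-1 -> inI m.+2 ->
  let F j := move j.+1 j in
  F m.-1 (F m (F m.+1 (F m f))) + F m (F m.-1 (F m (F m.+1 f)))
  + F m.+1 (F m (F m.-1 (F m f))) + F m (F m.+1 (F m (F m.-1 f)))
  - (q + q^-1) *: F m (F m.-1 (F m.+1 (F m f))) = 0.
Proof.
rewrite /inI => Nx Ny /=; have -> : m.-1.+1 = m by lia.
apply/ffunP => b; rewrite quartic_at [RHS]ffunE.
pose a := upd (upd (upd (upd (occ b) m m.-1) m.+1 m) m.+2 m.+1) m.+1 m.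
rewrite !(@run4 a); try (by moves_good); try (by moves_end a).
rewrite /upd; decide_eqs; rewrite /= ?addr0 ?subr0 ?subrK ?addrK.
have Nm1 : inI m.+1 by rewrite /inI; lia.
have [E|E] := occ_odd01 b Nm1 (ltnSn m).
  rewrite E !(phi_odd _ (ltnSn m)) /= ?add0r ?eqxx.
  by rewrite /=; ring.
rewrite E !(phi_odd _ (ltnSn m)) /= ?subrr ?eqxx.
transitivity (phi m.+2 (occ b m.+2) * coef_at f a *
   (phi m (occ b m + 1 + 1) - (q + q^-1) * phi m (occ b m + 1) + phi m (occ b m + 1 - 1))).
  by rewrite addrK; ring.
by rewrite phi_rec // mulr0.
Qed.


Definition diag_fun (c : (nat -> int) -> k) (f : fock) : fock :=
  [ffun b => c (occ b) * f b].

Lemma diag_is_linear c : linear (diag_fun c).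
Proof. by move=> a f g; apply/ffunP => b; rewrite !ffunE /GRing.scale /=; ring. Qed.

HB.instance Definition _ c :=
  GRing.isLinear.Build k fock fock _ (diag_fun c) (diag_is_linear c).

Definition diag c : {linear fock -> fock} := diag_fun c.

Definition extensional (c : (nat -> int) -> k) :=
  forall a a', (forall x, inI x -> a x = a' x) -> c a = c a'.

Lemma diagE c f b : diag c f b = c (occ b) * f b.
Proof. by rewrite ffunE. Qed.

Lemma moveE x y f b : move x y f b = phi x (occ b x) * coef_at f (upd (occ b) x y).
Proof. by rewrite ffunE. Qed.

Lemma coef_at_diag c f a : extensional c -> coef_at (diag c f) a = c a * coef_at f a.
Proof.
move=> lc; have [[b [Hb ->]]|[no ->]] := coef_at_spec (diag c f) a.
  by rewrite diagE (coef_at_occ f Hb) (lc _ _ Hb).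
have [[b [Hb _]]|[_ ->]] := coef_at_spec f a; last by rewrite mulr0.
by case: (no b).
Qed.

Lemma diag_move c e x y f : extensional c -> (forall a, c a = e * c (upd a x y)) ->
  diag c (move x y f) = e *: move x y (diag c f).
Proof.
move=> lc ce; apply/ffunP => b; rewrite [RHS]ffunE diagE !moveE coef_at_diag // ce.
by rewrite /GRing.scale /=; ring.
Qed.

Definition charge (i : nat) (a : nat -> int) : k := qi q m i ^ a i.

Definition torus_value (X : version) (i : nat) (a : nat -> int) : k :=
  if X is GL then charge i a else charge i a / charge i.+1 a.

Definition odd_number (a : nat -> int) : int := \sum_(m.+1 <= x < (m + n).+1) a x.

Definition odd_sign (a : nat -> int) : k := (-1) ^ odd_number a.

Definition fock_action (X : version) : action fock := Action
  (fun j => move j j.+1) (fun j => move j.+1 j)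
  (fun i => diag (torus_value X i)) (fun i => diag (fun a => (torus_value X i a)^-1))
  (diag odd_sign).

Lemma charge_neq0 i a : charge i a != 0.
Proof. by rewrite expfz_neq0 // qi_neq0. Qed.

Lemma torus_value_neq0 X i a : torus_value X i a != 0.
Proof. by case: X; rewrite /= ?mulf_neq0 ?invr_eq0 ?charge_neq0. Qed.

Lemma torus_value_extensional X i : inTorus X m n i -> extensional (torus_value X i).
Proof.
move=> Ti a a' E; rewrite /torus_value /charge; case: X Ti => /= Ti.
  by rewrite E.
by move: Ti; rewrite /inJ => Ti; rewrite !E // /inI; lia.
Qed.

Lemma charge_upd i j a : charge i a = Kchar q m i j * charge i (upd a j j.+1).
Proof.
rewrite /charge /Kchar -expfzDr ?qi_neq0 //; congr (_ ^ _).
by rewrite /upd; ring.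
Qed.

Lemma torus_value_E X i j a :
  torus_value X i a = torus_char X q m i j * torus_value X i (upd a j j.+1).
Proof.
case: X; rewrite /= (charge_upd i j a) ?(charge_upd i.+1 j a) //.
by rewrite invfM mulrACA.
Qed.

Lemma torus_value_F X i j a :
  torus_value X i a = (torus_char X q m i j)^-1 * torus_value X i (upd a j.+1 j).
Proof.
rewrite (torus_value_E X i j (upd _ _ _)) mulKf ?torus_char_neq0 //.
have E z : upd (upd a j.+1 j) j j.+1 z = a z by rewrite /upd; ring.
by rewrite /torus_value /charge !E.
Qed.

Lemma odd_number_upd a x y : inI x -> inI y ->
  odd_number (upd a x y) = odd_number a + (m < y)%:Z - (m < x)%:Z.
Proof.
have delta z : inI z -> \sum_(m.+1 <= x < (m + n).+1) (x == z)%:Z = (m < z)%:Z :> int.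
  rewrite /inI => Nz; have [lt|ge] := ltnP m z.
    rewrite (bigD1_seq z) ?iota_uniq //=; last by rewrite mem_index_iota; lia.
    by rewrite eqxx big1 ?addr0 // => i /negPf ->.
  rewrite big_seq_cond big1 // => i /andP[]; rewrite mem_index_iota => Hi _.
  by have -> : (i == z) = false by lia.
by move=> Nx Ny; rewrite /odd_number sumrB big_split /= !delta.
Qed.

Lemma odd_sign_extensional : extensional odd_sign.
Proof.
move=> a a' E; congr (_ ^ _); apply: eq_big_nat => x Hx; apply: E.
by rewrite /inI; lia.
Qed.

Lemma odd_sign_sqr a : odd_sign a * odd_sign a = 1.
Proof.
by rewrite /odd_sign -expfzMl mulrNN mulr1 exp1rz.
Qed.

Lemma odd_sign_upd a x y : inI x -> inI y ->
  odd_sign a * odd_sign (upd a x y) = (-1) ^+ ((m < x) (+) (m < y))%N.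
Proof.
move=> Nx Ny; rewrite /odd_sign odd_number_upd //.
have neg1 : (-1 : k) != 0 by rewrite oppr_eq0 oner_eq0.
rewrite !expfzDr // !mulrA -[_ ^ _ * _]/(odd_sign a * odd_sign a) odd_sign_sqr mul1r.
have neg1V : (-1 : k) ^ (- 1%:Z) = -1 by rewrite -invr_expz expr1z invrN1.
by case: (m < x)%N; case: (m < y)%N; rewrite /= ?oppr0 ?neg1V ?expr1z ?expr0z ?mulr1 ?mul1r ?mulrNN ?mulr1.
Qed.

Lemma inJ_inI j : inJ m n j -> inI j /\ inI j.+1.
Proof. by rewrite /inJ /inI; lia. Qed.

Lemma sigma_move x y f : inI x -> inI y -> x != y ->
  diag odd_sign (move x y (diag odd_sign f)) =
  (-1) ^+ ((m < x) (+) (m < y))%N *: move x y f.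
Proof.
move=> Nx Ny ne; apply/ffunP => b; rewrite [RHS]ffunE diagE !moveE coef_at_diag; last exact: odd_sign_extensional.
by rewrite -(odd_sign_upd (occ b) Nx Ny) /GRing.scale /=; ring.
Qed.

Lemma fock_torus_relations X : torus_relations X q m n (fock_action X).
Proof.
split=> /=.
- by move=> i j f _ _; apply/ffunP => b; rewrite !diagE; ring.
- move=> i f _; have nz b := torus_value_neq0 X i (occ b).
  by split; apply/ffunP => b; rewrite !diagE ?mulVKf ?mulKf.
- move=> i j f Ti Jj; have [Nj NSj] := inJ_inI Jj; apply: diag_move; first exact: torus_value_extensional.
  by move=> a; apply: torus_value_E.
- move=> i j f Ti Jj; have [Nj NSj] := inJ_inI Jj; apply: diag_move; first exact: torus_value_extensional.
  by move=> a; apply: torus_value_F.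
Qed.

Lemma fock_sigma_relations X : sigma_relations X m n (fock_action X).
Proof.
split=> /=.
- by move=> f; apply/ffunP => b; rewrite !diagE mulrA odd_sign_sqr mul1r.
- move=> j f Jj; have [Nj NSj] := inJ_inI Jj; rewrite sigma_move //; last lia.
  by congr (_ ^+ _ *: _); rewrite /parity; case: ltngtP => //=; lia.
- move=> j f Jj; have [Nj NSj] := inJ_inI Jj; rewrite sigma_move //; last lia.
  by congr (_ ^+ _ *: _); rewrite /parity; case: ltngtP => //=; lia.
- move=> i f Ti; apply/ffunP => b; rewrite !diagE.
  by rewrite -[RHS]mulr1 -(odd_sign_sqr (occ b)); ring.
Qed.

Lemma fock_Serre_E X : Serre_relations q m n (actE (fock_action X)).
Proof.
split=> /=.
- move=> i j f Ji Jj ij; have [Ni NSi] := inJ_inI Ji; have [Nj NSj] := inJ_inI Jj.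
  by apply: moveC => //; lia.
- move=> i j f Ji Jj ij im; have [Ni NSi] := inJ_inI Ji; have [Nj NSj] := inJ_inI Jj.
  by case/orP: ij => /eqP E; subst; [apply: serre_target|apply: serre_source]; rewrite ?inE; lia.
- by move=> f Jm; have [Nm NSm] := inJ_inI Jm; apply: move_sqr0 => //; lia.
- move=> f J1 _ J2; apply: quartic_E; [by case/inJ_inI: J1|by case/inJ_inI: J2].
Qed.

Lemma fock_Serre_F X : Serre_relations q m n (actF (fock_action X)).
Proof.
split=> /=.
- move=> i j f Ji Jj ij; have [Ni NSi] := inJ_inI Ji; have [Nj NSj] := inJ_inI Jj.
  by apply: moveC => //; lia.
- move=> i j f Ji Jj ij im; have [Ni NSi] := inJ_inI Ji; have [Nj NSj] := inJ_inI Jj.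
  by case/orP: ij => /eqP E; subst; [apply: serre_source|apply: serre_target]; rewrite ?inE; lia.
- by move=> f Jm; have [Nm NSm] := inJ_inI Jm; apply: move_sqr0 => //; lia.
- move=> f J1 _ J2; apply: quartic_F; [by case/inJ_inI: J1|by case/inJ_inI: J2].
Qed.

Lemma calK_fock X i f b : calK X (fock_action X) i f b =
  charge i (occ b) / charge i.+1 (occ b) * f b.
Proof. by case: X; rewrite /calK /= !diagE ?mulrA. Qed.

Lemma calKV_fock X i f b : calKV X (fock_action X) i f b =
  (charge i (occ b) / charge i.+1 (occ b))^-1 * f b.
Proof.
by case: X; rewrite /calKV /= !diagE ?mulrA // invf_div [_^-1 * _]mulrC.
Qed.

(** The commutator of E_i and F_i on a state.  For two even positions this is
    [a][b+1] - [b][a+1] = [a-b]; at an odd position only the values 0 and 1 have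
    to be checked. *)
Lemma phi_commutator i b : inJ m n i ->
  phi i (occ b i) * phi i.+1 (occ b i.+1 + 1)
    - (-1) ^+ (parity m i * parity m i) * (phi i.+1 (occ b i.+1) * phi i (occ b i + 1))
  = (qi q m i - (qi q m i)^-1)^-1 *
    (charge i (occ b) / charge i.+1 (occ b) - (charge i (occ b) / charge i.+1 (occ b))^-1).
Proof.
move=> Ji; have [Ni NSi] := inJ_inI Ji; rewrite /parity /charge /qi.
have H := q2V_neq1; have H0 := q_qV_neq0.
have H' : 1 + - q * q != 0 by rewrite mulNr -opprB oppr_eq0.
case: (ltngtP i m) => [lt|gt|E].
- rewrite /phi (ltnW lt) lt mul0n expr0 mul1r qnumB.
  have u : q ^ occ b i != 0 by rewrite expfz_neq0.
  have v : q ^ occ b i.+1 != 0 by rewrite expfz_neq0.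
  rewrite /qnum opprB !expfzDr // -!invr_expz.
  by field; rewrite u v q_neq0 H.
- rewrite !phi_odd; try lia.
  rewrite /= mul0n expr0 mul1r invrK.
  have [E1|E1] := occ_odd01 b Ni gt; have [E2|E2] := occ_odd01 b NSi (ltnW gt);
    rewrite E1 E2 /= ?expr0z ?expr1z ?mulr1 ?mul1r ?mulr0 ?mul0r ?invr1 ?subrr ?mulr0 //.
  + by field; rewrite ?q_neq0 ?oner_neq0 ?H'.
  + by field; rewrite ?q_neq0 ?oner_neq0 ?H' ?H.
  + by rewrite divff ?invr_eq0 // invr1 subrr mulr0.
- subst i; rewrite !(phi_odd _ (ltnSn m)) mul1n expr1 /phi leqnn.
  have u : q ^ occ b m != 0 by rewrite expfz_neq0.
  have [E2|E2] := occ_odd01 b NSi (ltnSn m); rewrite E2 /= ?expr0z ?expr1z /qnum ?opprD ?expfzDr // -?invr_expz ?expr1z.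
  + by rewrite !divr1; field; rewrite ?u ?q_neq0 ?H.
  + by rewrite invf_div invrK; field; rewrite ?u ?q_neq0 ?H.
Qed.

Lemma fock_EF_relation X : EF_relation X q m n (fock_action X).
Proof.
move=> i j f Ji Jj; have [Ni NSi] := inJ_inI Ji; have [Nj NSj] := inJ_inI Jj.
have [E|ne] := eqVneq i j; last first.
  have -> : (parity m i * parity m j)%N = 0%N by rewrite /parity; lia.
  by rewrite scale0r expr0 scale1r /= moveC ?subrr //; lia.
subst j; apply/ffunP => b; rewrite scale1r.
have EF_at (f1 f2 f3 f4 : fock) c d :
    (f1 - c *: f2) b = f1 b - c * f2 b /\ (d *: (f3 - f4)) b = d * (f3 b - f4 b).
  by rewrite !ffunE.
rewrite (EF_at _ _ 0 0 _ 0).1 (EF_at 0 0 _ _ 0 _).2 calK_fock calKV_fock -mulrBl mulrA.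
rewrite /inI in Ni NSi.
rewrite -phi_commutator //= !(@run2 (occ b)); try (by moves_good); try (by move=> z; rewrite /upd; ring).
rewrite (@coef_at_occ _ b) // /upd; decide_eqs.
by rewrite /= ?addr0 ?subr0; ring.
Qed.

Lemma fock_is_module X : is_module X q m n (fock_action X).
Proof.
split; [exact: fock_torus_relations|exact: fock_EF_relation|exact: fock_Serre_E
  |exact: fock_Serre_F|exact: fock_sigma_relations].
Qed.


Lemma run_coef_nseq r x y a : x != y -> 0 <= a x -> a x < r%:Z ->
  run_coef (nseq r (x, y)) a = 0.
Proof.
move=> ne; elim: r a => [|r IHr] a a_ge0 lt /=; first by lia.
have [->|ax] := eqVneq (a x) 0; first by rewrite phi0 mul0r.
by rewrite IHr ?mulr0 // /upd eqxx (negPf ne); lia.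
Qed.

(** A state with fewer than r units at x is not reached by r moves to x. *)
Lemma iter_move r x y f b : inI x -> inI y -> x != y -> occ b x < r%:Z ->
  iter r (move x y) f b = 0.
Proof.
move=> Nx Ny ne lt.
have -> : iter r (move x y) f = run (nseq r (x, y)) f.
  by elim: {lt} r => //= r ->.
rewrite run_at; last first.
  by apply/allP => xy /nseqP[-> _]; rewrite /= Nx Ny.
by rewrite run_coef_nseq ?mul0r //; apply: nonneg_occ.
Qed.

Lemma occ_lt_l b x : (2 < l)%N -> inI x -> occ b x < l%:Z.
Proof.
move=> l_gt2 Nx; have := occ_admissible b Nx; rewrite /admissible.
by case: ifP => _ /andP[_]; [case: eqP => //=; lia|lia].
Qed.

Lemma charge_period i a : (2 < l)%N -> charge i a ^+ (2 * l) = 1.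
Proof.
move=> l_gt2; have q2l : q ^+ (2 * l) = 1.
  have : qint q l = 0 by case: l l_char l_gt2 => // l' [].
  move=> /eqP; rewrite mulf_eq0 invr_eq0 (negPf q_qV_neq0) orbF subr_eq0 => /eqP E.
  by rewrite mul2n -addnn exprD {2}E mulfV // expf_neq0.
have qi2l : qi q m i ^+ (2 * l) = 1.
  by rewrite /qi; case: ifP => // _; rewrite exprVn q2l invr1.
by rewrite /charge exprnP exprzAC -[X in X ^ _]exprnP qi2l exp1rz.
Qed.

Lemma fock_restricted X : (2 < l)%N -> restricted_relations X m n (fock_action X) l.
Proof.
move=> l_gt2; split.
- move=> j f Jj _; have [Nj NSj] := inJ_inI Jj; apply/ffunP => b; rewrite [RHS]ffunE /=.
  by apply: iter_move => //; [lia|exact: occ_lt_l].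
- move=> j f Jj _; have [Nj NSj] := inJ_inI Jj; apply/ffunP => b; rewrite [RHS]ffunE /=.
  by apply: iter_move => //; [lia|exact: occ_lt_l].
- move=> i f _; apply/ffunP => b /=.
  have -> r : iter r (diag (torus_value X i)) f b = torus_value X i (occ b) ^+ r * f b.
    by elim: r => [|r IHr]; rewrite ?mul1r //= diagE IHr exprS mulrA.
  suff -> : torus_value X i (occ b) ^+ (2 * l) = 1 by rewrite mul1r.
  case: X => /=; first exact: charge_period.
  by rewrite expr_div_n !charge_period // divr1.
Qed.

(** * Simplicity *)

(** Each E_j lowers the height by one and each F_j raises it by one, so that it
    serves as induction measure in both directions. *)
Definition height (b : state) : nat :=
  absz (\sum_(1 <= x < (m + n).+1) x%:Z * occ b x).

Lemma heightE b : (height b)%:Z = \sum_(1 <= x < (m + n).+1) x%:Z * occ b x.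
Proof.
rewrite /height gez0_abs // big_seq; apply: sumr_ge0 => x; rewrite mem_index_iota => Hx.
by apply: mulr_ge0 => //; apply: nonneg_occ; rewrite /inI; lia.
Qed.

Lemma height_upd b b' x y : inI x -> inI y ->
  (forall z, inI z -> occ b' z = upd (occ b) x y z) ->
  (height b')%:Z = (height b)%:Z + y%:Z - x%:Z.
Proof.
move=> Nx Ny E; have delta z : inI z ->
    \sum_(1 <= x < (m + n).+1) x%:Z * (x == z)%:Z = z%:Z :> int.
  rewrite /inI => Nz; rewrite (bigD1_seq z) ?iota_uniq //=; last by rewrite mem_index_iota; lia.
  by rewrite eqxx mulr1 big1 ?addr0 // => i /negPf ->; rewrite mulr0.
rewrite !heightE -(delta y Ny) -(delta x Nx) -big_split -sumrB /=.
apply: eq_big_nat => z Hz; rewrite E; last by rewrite /inI; lia.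
by rewrite /upd; ring.
Qed.

(** Whether a unit can be moved from position j + 1 to position j. *)
Definition raisable (b : state) (j : nat) : bool :=
  (occ b j.+1 != 0) && admissible j (occ b j + 1).

Definition greedy (b : state) : bool :=
  ~~ has (raisable b) (iota 1 (m + n).-1).

Lemma not_greedy b : ~~ greedy b -> exists2 j, inJ m n j & raisable b j.
Proof.
rewrite negbK => /hasP[j]; rewrite mem_iota => Jj Hj; exists j => //.
by rewrite /inJ; lia.
Qed.

Lemma greedyP b j : greedy b -> inJ m n j -> raisable b j = false.
Proof.
move=> /hasPn H Jj; apply/negbTE/H; rewrite mem_iota; move: Jj; rewrite /inJ; lia.
Qed.

Lemma raise_state b j : inJ m n j -> raisable b j ->
  exists2 b', (forall z, inI z -> occ b' z = upd (occ b) j.+1 j z) & height b = (height b').+1.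
Proof.
move=> Jj /andP[nz adm]; have [Nj NSj] := inJ_inI Jj.
have [z Nz||b' Hb'] := @state_exists (upd (occ b) j.+1 j).
- rewrite /upd; have [->|nzj] := eqVneq z j.
    rewrite (_ : (j == j.+1) = false) ?subr0 //; lia.
  have := occ_admissible b Nz; rewrite /admissible addr0.
  have [->|_] := eqVneq z j.+1; last by rewrite subr0.
  have := nonneg_occ b NSj; case: ifP => _; [case: (l == 0%N) => /=|]; lia.
- by rewrite upd_sum // occ_sum.
exists b' => //; have := height_upd NSj Nj Hb'; lia.
Qed.

Definition basis (b : state) : fock := [ffun b' => (b' == b)%:R].

Lemma fock_basis (f : fock) : f = \sum_b f b *: basis b.
Proof.
apply/ffunP => b; rewrite sum_ffunE (bigD1 b) //= big1 => [|b' ne].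
  by rewrite addr0 !ffunE eqxx /GRing.scale /= mulr1.
by rewrite !ffunE eq_sym (negPf ne) /GRing.scale /= mulr0.
Qed.

(** If a unit of the state b can be moved to j, the state that results is reached
    by E_j from b alone, with a nonzero coefficient; so E_j f = 0 forces f b = 0. *)
Lemma singular_greedy f b : (forall j, inJ m n j -> move j j.+1 f = 0) ->
  ~~ greedy b -> f b = 0.
Proof.
move=> Ef /not_greedy[j Jj Rj]; have [b' Hb' _] := raise_state Jj Rj.
have [Nj NSj] := inJ_inI Jj; have /andP[nz adm] := Rj.
have /ffunP/(_ b') := Ef j Jj; rewrite [RHS]ffunE moveE.
rewrite (@coef_at_occ _ b); last by move=> z Nz; rewrite {1}/upd Hb' // /upd; ring.
have E : occ b' j = occ b j + 1.
  rewrite Hb' // /upd eqxx (_ : (j == j.+1) = false) ?subr0 //; lia.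
move/eqP; rewrite mulf_eq0 E => /orP[|/eqP//].
rewrite (negPf (phi_neq0 adm _)) //; have := nonneg_occ b Nj; lia.
Qed.

(** Conversely a state that is not greedy is reached by some F_j from a state of
    smaller height. *)
Lemma basis_lower b j : inJ m n j -> raisable b j ->
  exists b' (c : k), [/\ c != 0, height b = (height b').+1 &
    move j.+1 j (basis b') = c *: basis b].
Proof.
move=> Jj Rj; have [b' Hb' Eh] := raise_state Jj Rj.
have [Nj NSj] := inJ_inI Jj; have /andP[nz adm] := Rj.
exists b', (phi j.+1 (occ b j.+1)); split=> //.
  by apply: phi_neq0 => //; apply: occ_admissible.
apply/ffunP => b1; rewrite moveE [RHS]ffunE ffunE /GRing.scale /=.
have [->|ne] := eqVneq b1 b; first by rewrite (@coef_at_occ _ b') // ffunE eqxx.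
rewrite mulr0; have [[b2 [Hb2 ->]]|[_ ->]] := coef_at_spec (basis b') (upd (occ b1) j.+1 j); last by rewrite mulr0.
rewrite ffunE; have [E|_] := eqVneq b2 b'; last by rewrite mulr0.
case/eqP: ne; apply: occ_inj => z Nz; subst b2.
by have := Hb2 z Nz; rewrite Hb' // /upd => /addIr/addIr.
Qed.

(** Compare two greedy states at the first position where they differ.  The
    smaller one is not full there, hence empty afterwards, and its degree is too
    small. *)
Lemma greedy_unique b b' : greedy b -> greedy b' -> b = b'.
Proof.
move=> gb gb'; apply: occ_inj.
have [/allP H x Nx|/allPn[x0 Hx0 ne0]] := boolP (all (fun x => occ b x == occ b' x) (iota 1 (m + n))).
  by apply/eqP/H; rewrite mem_iota; move: Nx; rewrite /inI; lia.
have ex : exists x, inI x && (occ b x != occ b' x).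
  by exists x0; rewrite ne0 andbT; move: Hx0; rewrite mem_iota /inI; lia.
case: (ex_minnP ex) => x /andP[Nx ne] min_x {ex x0 Hx0 ne0}.
wlog lt : b b' gb gb' ne min_x / occ b x < occ b' x.
  move=> H; have := ne; rewrite neq_lt => /orP[lt|lt]; first exact: (H b b').
  move=> y Ny; symmetry; apply: (H b' b) => //; first by rewrite eq_sym.
  by move=> z; rewrite eq_sym; apply: min_x.
have after y : (x < y)%N -> inI y -> occ b y = 0.
  elim: y => // y IHy lt_xy NSy.
  have Jy : inJ m n y by move: Nx NSy lt_xy; rewrite /inI /inJ; lia.
  have [Ny _] := inJ_inI Jy.
  apply/eqP/contraT => nz; move: (greedyP gb Jy); rewrite /raisable nz /= => /negP; case.
  have [E|gt] := eqVneq x y.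
    subst y; have := occ_admissible b' Nx; have := nonneg_occ b Nx.
    rewrite /admissible; case: ifP => _; [case: (l == 0%N) => /=|]; lia.
  rewrite IHy //; last lia.
  rewrite add0r /admissible; case: ifP => //= _; apply/orP.
  by case: l_range => H; [left; apply/eqP|right; lia].
have : \sum_(1 <= y < (m + n).+1) occ b y < \sum_(1 <= y < (m + n).+1) occ b' y.
  rewrite (bigD1_seq x) ?iota_uniq ?[ltRHS](bigD1_seq x) ?iota_uniq //=;
    try by move: Nx; rewrite mem_index_iota /inI; lia.
  apply: ltr_leD => //; rewrite big_seq_cond [leRHS]big_seq_cond; apply: ler_sum => y.
  rewrite mem_index_iota => /andP[Hy nyx]; have Ny : inI y by rewrite /inI; lia.
  have [lt_yx|] := ltnP y x.
    by case: eqP (min_x y) => [->//|_]; rewrite Ny /= => /(_ isT); lia.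
  move=> ge; rewrite after //; [exact: nonneg_occ|lia].
by rewrite !occ_sum ltxx.
Qed.

Section Top.

Variables (X : version) (top : state).
Hypothesis top_greedy : greedy top.

Lemma singular_top f : (forall j, inJ m n j -> move j j.+1 f = 0) -> f = f top *: basis top.
Proof.
move=> Ef; apply/ffunP => b; rewrite !ffunE /GRing.scale /=.
have [->|ne] := eqVneq b top; first by rewrite mulr1.
rewrite mulr0; apply: singular_greedy => //; apply: contra ne => gb.
exact/eqP/greedy_unique.
Qed.

Lemma height_move j f b : inJ m n j ->
  (move j j.+1 f b != 0 -> exists2 b', f b' != 0 & height b' = (height b).+1) /\
  (move j.+1 j f b != 0 -> exists2 b', f b' != 0 & height b = (height b').+1).
Proof.
move=> Jj; have [Nj NSj] := inJ_inI Jj; rewrite !moveE; split.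
  have [[b' [Hb' ->]]|[_ ->]] := coef_at_spec f (upd (occ b) j j.+1); last by rewrite mulr0 eqxx.
  rewrite mulf_eq0 negb_or => /andP[_ nz]; exists b' => //.
  by have := height_upd Nj NSj Hb'; lia.
have [[b' [Hb' ->]]|[_ ->]] := coef_at_spec f (upd (occ b) j.+1 j); last by rewrite mulr0 eqxx.
rewrite mulf_eq0 negb_or => /andP[_ nz]; exists b' => //.
by have := height_upd NSj Nj Hb'; lia.
Qed.

Section Submodule.

Variable W : fock -> Prop.
Hypothesis subW : is_submodule X m n (fock_action X) W.

Lemma submoduleZ c f : W f -> W (c *: f).
Proof.
case: subW => [[W0 WZ] _ _ _] Wf; rewrite -[_ *: f]addr0; exact: WZ.
Qed.

(** Applying the E_j to a nonzero vector decreases its largest height, and the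
    process can only stop at a multiple of the greedy state. *)
Lemma submodule_top f : W f -> f != 0 -> W (basis top).
Proof.
suff H N : forall f, W f -> f != 0 -> (forall b, f b != 0 -> (height b < N)%N) -> W (basis top).
  move=> Wf nz; apply: (H (\max_b height b).+1 f) => // b _.
  by rewrite ltnS; apply: leq_bigmax.
elim: N => [|N IHN] {}f Wf nz Hf.
  case/eqP: nz; apply/ffunP => b; rewrite [RHS]ffunE; apply/eqP/contraT => /Hf; by rewrite ltn0.
have [/allP E0|/allPn[j Hj nE]] := boolP (all (fun j => move j j.+1 f == 0) (iota 1 (m + n).-1)).
  have E : f = f top *: basis top.
    apply: singular_top => j Jj; apply/eqP/E0; rewrite mem_iota; move: Jj; rewrite /inJ; lia.
  have ft : f top != 0 by apply: contra nz => /eqP f0; rewrite E f0 scale0r.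
  by rewrite -[basis top](scalerK ft) -E; apply: submoduleZ.
have Jj : inJ m n j by move: Hj; rewrite mem_iota /inJ; lia.
apply: (IHN (move j j.+1 f)) => // [|b nb].
  by case: subW => _ /(_ j f Jj Wf) [].
by have [/(_ nb)[b' /Hf lt Eh] _] := height_move f b Jj; lia.
Qed.

(** From the greedy state all others are reached by the F_j. *)
Lemma submodule_full : W (basis top) -> forall f, W f.
Proof.
move=> Wtop; have Wb N : forall b, (height b <= N)%N -> W (basis b).
  elim: N => [|N IHN] b Hb.
    have [gb|/not_greedy[j Jj Rj]] := boolP (greedy b); first by rewrite (greedy_unique gb top_greedy).
    by have [b' [c [_ Eh _]]] := basis_lower Jj Rj; lia.
  have [gb|/not_greedy[j Jj Rj]] := boolP (greedy b); first by rewrite (greedy_unique gb top_greedy).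
  have [b' [c [c0 Eh Ec]]] := basis_lower Jj Rj.
  rewrite -[basis b](scalerK c0) -Ec; apply: submoduleZ.
  case: subW => _ /(_ j (basis b') Jj) H _ _.
  by have [] := H (IHN b' ltac:(lia)).
move=> f; rewrite (fock_basis f); apply: (big_ind W) => [|f1 f2 W1 W2|b _].
- by case: subW => [[]].
- by case: subW => [[_ WZ] _ _ _]; rewrite -[f1]scale1r; apply: WZ.
- by apply: submoduleZ; apply: Wb (leqnn _).
Qed.

End Submodule.

Lemma basis_neq0 b : basis b != 0.
Proof.
apply/eqP => /ffunP/(_ b); rewrite !ffunE eqxx => /eqP; by rewrite oner_eq0.
Qed.

Lemma fock_is_simple : is_simple X m n (fock_action X).
Proof.
split; first by exists (basis top); apply: basis_neq0.
move=> W subW; have [Wtop|nWtop] := Classical_Prop.classic (W (basis top)).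
  by right; apply: submodule_full.
left=> f Wf; apply/eqP; apply: contraT => nz; case: nWtop; exact: submodule_top Wf nz.
Qed.

Lemma fock_generated : generated_by X m n (fock_action X) (basis top).
Proof. by move=> W subW Wtop; apply: submodule_full. Qed.

Lemma fock_F_nilpotent f : F_nilpotent m n (fock_action X) f.
Proof.
exists (\max_b height b).+1 => s Js Hs; apply/ffunP => b; rewrite [RHS]ffunE.
apply/eqP; apply: contraT => nz.
have : (size s <= height b)%N.
  elim: s Js b nz {Hs} => //= j s IHs /andP[Jj Js] b nz.
  by have [_ /(_ nz)[b' /(IHs Js) le ->]] := height_move (foldr (fun j w => move j.+1 j w) f s) b Jj.
have := leq_bigmax (F := height) b; lia.
Qed.

Variable lam : weight.
Hypothesis top_lam : forall x, inI x -> occ top x = lam x.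

Lemma wform_eps i : inI i -> wform m n lam (eps i) = if (i <= m)%N then lam i else - lam i.
Proof.
rewrite /inI => Ni; rewrite /wform (bigD1_seq i) ?iota_uniq //=; last by rewrite mem_index_iota; lia.
rewrite big1 => [|x /negPf ne]; first by rewrite /eps eqxx mulr1 addr0.
by rewrite /eps eq_sym ne mulr0 oppr0 if_same.
Qed.

Lemma wformD x y : wform m n lam (wadd x (wscale (-1) y)) = wform m n lam x - wform m n lam y.
Proof.
rewrite /wform -sumrB; apply: eq_bigr => i _; rewrite /wadd /wscale.
by case: ifP => _; ring.
Qed.

Lemma charge_top i : inI i -> charge i (occ top) = q ^ wform m n lam (eps i).
Proof.
move=> Ni; rewrite wform_eps // /charge top_lam // /qi; case: ifP => // _.
by rewrite exprz_inv.
Qed.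

Lemma fock_highest : highest_weight_vector X q m n (fock_action X) lam (basis top).
Proof.
split; first exact: basis_neq0.
- move=> j Jj /=; have [Nj NSj] := inJ_inI Jj.
  apply/ffunP => b; rewrite moveE [RHS]ffunE.
  have [[b' [Hb' ->]]|[_ ->]] := coef_at_spec (basis top) (upd (occ b) j j.+1); last by rewrite mulr0.
  rewrite ffunE; have [E|_] := eqVneq b' top; last by rewrite mulr0.
  subst b'; have := greedyP top_greedy Jj; rewrite /raisable !Hb' // /upd !eqxx.
  have -> : (j == j.+1) = false by lia.
  have -> : (j.+1 == j) = false by lia.
  rewrite /= ?oppr0 ?addr0 ?subr0 subrK (occ_admissible b Nj) andbT => /negbFE/eqP E.
  by have := nonneg_occ b NSj; lia.
- move=> i Ti /=; apply/ffunP => b; rewrite diagE [RHS]ffunE ffunE /GRing.scale /=.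
  have [->|_] := eqVneq b top; last by rewrite !mulr0.
  rewrite !mulr1 /torus_value /torus_weight; case: X Ti => /= Ti; first exact: charge_top.
  have [Ni NSi] := inJ_inI Ti.
  by rewrite !charge_top // wformD expfzDr // invr_expz.
Qed.

Lemma fock_is_Vlam : is_Vlam X q m n (fock_action X) lam.
Proof.
split; [exact: fock_is_module|exact: fock_is_simple|].
by exists (basis top); split; [exact: fock_highest|exact: fock_generated].
Qed.

Lemma fock_is_Vlam_restricted : (2 < l)%N ->
  is_Vlam_restricted X q m n (fock_action X) l lam.
Proof.
move=> l_gt2.
split; [exact: fock_is_module|exact: fock_restricted|exact: fock_is_simple|].
exists (basis top); split; [exact: fock_highest|exact: fock_generated|exact: fock_F_nilpotent].
Qed.

End Top.

Lemma fock_has_dim : has_dim (fun _ : fock => True) #|{: state}|.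
Proof.
exists (fun i => basis (enum_val i)); split=> // [c S0 i|f _].
  have /ffunP/(_ (enum_val i)) := S0; rewrite sum_ffunE [RHS]ffunE (bigD1 i) //= big1 => [|j ne].
    by rewrite addr0 !ffunE eqxx /GRing.scale /= mulr1.
  rewrite !ffunE; case: eqP => [E|_]; last by rewrite /GRing.scale /= mulr0.
  by case/eqP: ne; apply: enum_val_inj; rewrite E.
exists (fun i => f (enum_val i)); rewrite {1}(fock_basis f).
by rewrite (reindex (@enum_val _ (mem {: state}))) //=; exists enum_rank => x _; rewrite ?enum_valK ?enum_rankK.
Qed.

Lemma greedy_state (lam : weight) : (forall x, inI x -> admissible x (lam x)) ->
  \sum_(1 <= x < (m + n).+1) lam x = t%:Z ->
  (forall j, inJ m n j -> (lam j.+1 == 0) || ~~ admissible j (lam j + 1)) ->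
  exists2 top, greedy top & forall x, inI x -> occ top x = lam x.
Proof.
move=> adm sum_lam H; have [top Htop] := state_exists adm sum_lam.
exists top => //; apply/hasPn => j; rewrite mem_iota => Hj.
have Jj : inJ m n j by rewrite /inJ; lia.
by have [Nj NSj] := inJ_inI Jj; rewrite /raisable !Htop // negb_and negbK H.
Qed.

End Fock.

(** * Dimensions and counting *)

Section Dimension.

Variable k : fieldType.

Lemma has_dim_unique (V : lmodType k) (W : V -> Prop) d d' :
  has_dim W d -> has_dim W d' -> d = d'.
Proof.
suff le e e' : has_dim W e -> has_dim W e' -> (e <= e')%N.
  by move=> H H'; apply/eqP; rewrite eqn_leq !le.
move=> [b [Wb free_b _]] [b' [_ _ span_b']].
have [M HM] := fin_all_exists (fun i => span_b' (b i) (Wb i)).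
pose A : 'M[k]_(e, e') := \matrix_(i, j) M i j.
suff : row_free A by move/eqP <-; apply: rank_leq_col.
apply/row_freeP; have [//|] := boolP (row_free A); first by move/row_freeP.
rewrite -kermx_eq0 => /rowV0Pn[u /sub_kermxP uA u0].
case/eqP: u0; apply/rowP => i; rewrite mxE; apply: (free_b (fun i => u 0 i)).
transitivity (\sum_j (u *m A) 0 j *: b' j); last by rewrite uA big1 // => j _; rewrite mxE scale0r.
under eq_bigr => j _ do rewrite HM scaler_sumr.
rewrite exchange_big /=; apply: eq_bigr => j _; rewrite mxE scaler_suml.
by apply: eq_bigr => x _; rewrite mxE scalerA.
Qed.

(** The dimension of a coordinate subspace whose coordinates are listed by g. *)
Lemma has_dim_free_span (T : finType) (I : choiceType) (g : T -> I) (P : pred T)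
    (S : {malg k[I]} -> Prop) :
  injective g -> (forall w, S w <-> exists2 x, P x & w = << g x >>) ->
  has_dim (lspan S) #|P|.
Proof.
move=> g_inj SP; have coefU x y : (<< g x >> : {malg k[I]})@_(g y) = (x == y)%:R.
  by rewrite mcoeffU (inj_eq g_inj).
have S_enum (i : 'I_#|P|) : S << g (enum_val i) >>.
  by apply/SP; exists (enum_val i) => //; apply: (enum_valP i).
exists (fun i => << g (enum_val i) >>); split.
- move=> i; exists 1%N, (fun => 1), (fun => << g (enum_val i) >>).
  by split=> //; rewrite big_ord1 scale1r.
- move=> c S0 i; have := congr1 (fun v => v@_(g (enum_val i))) S0.
  rewrite mcoeff0 raddf_sum /= (bigD1 i) //= big1 => [|j ne].
    by rewrite addr0 mcoeffZ coefU eqxx mulr1.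
  rewrite mcoeffZ coefU; case: eqP => [E|_]; last by rewrite mulr0.
  by case/eqP: ne; apply: enum_val_inj.
- move=> v [r [c [w [Sw ->]]]].
  have H j : exists i : 'I_#|P|, w j = << g (enum_val i) >>.
    have /SP[x Px ->] := Sw j; exists (enum_rank_in Px x).
    by rewrite enum_rankK_in.
  have [f Hf] := fin_all_exists H.
  exists (fun i => \sum_(j | f j == i) c j).
  rewrite (partition_big f xpredT) //=; apply: eq_bigr => i _.
  by rewrite scaler_suml; apply: eq_bigr => j /eqP <-; rewrite Hf.
Qed.

End Dimension.

Section Counting.

(** The generating polynomial of a degree function; it turns products of index
    sets into products of polynomials. *)
Definition degree_poly (T : finType) (deg : T -> nat) : {poly int} := \sum_x 'X^(deg x).

Lemma coef_degree_poly (T : finType) (deg : T -> nat) s :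
  (degree_poly deg)`_s = #|[pred x | deg x == s]|%:Z.
Proof.
rewrite coef_sum; under eq_bigr => x _ do rewrite coefXn.
by rewrite -sum1_card -natz natr_sum [RHS]big_mkcond; apply: eq_bigr => x _; rewrite inE eq_sym; case: eqP.
Qed.

Lemma degree_poly_prod (T U : finType) (deg : T -> nat) (deg' : U -> nat) :
  degree_poly (fun x : T * U => deg x.1 + deg' x.2)%N = degree_poly deg * degree_poly deg'.
Proof.
rewrite /degree_poly big_distrl /=.
under [RHS]eq_bigr => x _ do rewrite big_distrr /=.
by rewrite pair_big /=; apply: eq_bigr => x _; rewrite exprD.
Qed.

Lemma degree_poly_ffun (T : finType) (deg : T -> nat) m :
  degree_poly (fun a : {ffun 'I_m -> T} => \sum_i deg (a i))%N = degree_poly deg ^+ m.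
Proof.
rewrite /degree_poly -[m in RHS]card_ord -prodr_const bigA_distr_bigA /=.
by apply: eq_bigr => a _; rewrite expr_sum.
Qed.

Definition geom (L : nat) : {poly int} := \sum_(j < L) 'X^j.

Lemma geomE L : (1 - 'X) * geom L = 1 - 'X^L.
Proof. by have := subrX1 ('X : {poly int}) L; rewrite /geom => H; rewrite -opprB mulNr -H opprB. Qed.

(** Multisets are counted by multiplying with 1 - X, which turns the recursion
    into Pascal's rule; the truncation at L is invisible below degree L. *)
Lemma coef_geom_pow L m s : (s < L)%N -> (geom L ^+ m.+1)`_s = 'C(m + s, s)%:Z.
Proof.
elim: m s => [|m IHm] s lt.
  rewrite expr1 add0n binn coef_sum (bigD1 (Ordinal lt)) //= coefXn eqxx big1 ?addr0 // => j ne.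
  rewrite coefXn; case: eqP => // E; case/eqP: ne; exact: val_inj.
have rec s' : (s' < L)%N -> ((1 - 'X) * geom L ^+ m.+2)`_s' = 'C(m + s', s')%:Z.
  move=> lt'; rewrite [_ ^+ m.+2]exprS mulrA geomE mulrBl mul1r coefB mulrC coefMXn lt' subr0.
  exact: IHm.
elim: s lt => [|s IHs] lt.
  have := rec 0%N lt; rewrite mulrBl mul1r coefB [_ * _]mulrC coefMX subr0 => ->.
  by rewrite !bin0.
have := rec _ lt; rewrite mulrBl mul1r coefB [_ * _]mulrC coefMX /= IHs ?(ltnW lt) //.
move/eqP; rewrite subr_eq => /eqP ->.
by rewrite [in RHS]addSn binS PoszD addSnnS.
Qed.

(** Instead of dividing by (1 - X)^m, the identity
    (1 + ... + X^(L-1))^m (1 - X^(s+1))^m = (1 - X^L)^m (1 + ... + X^s)^m is read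
    in degree s: the second factor contributes its constant term 1 only, and the
    coefficients of the last one are those of coef_geom_pow. *)
Lemma coef_truncated L m s : (0 < m)%N -> (0 < L)%N -> (geom L ^+ m)`_s =
  \sum_(0 <= i < (s %/ L).+1) (-1) ^+ i * 'C(m, i)%:Z * 'C(m + s - i * L - 1, m - 1)%:Z.
Proof.
move=> m_gt0 L_gt0; have E : geom L ^+ m * (1 - 'X^(s.+1)) ^+ m = (1 - 'X^L) ^+ m * geom s.+1 ^+ m.
  by rewrite -!geomE !exprMn; ring.
have [Q EQ] : exists Q : {poly int}, (1 - 'X^(s.+1)) ^+ m = 1 + Q * 'X^(s.+1).
  elim: (m) => [|p [Q IH]]; first by exists 0; rewrite mul0r addr0.
  by exists (Q - 1 - Q * 'X^(s.+1)); rewrite exprS IH; ring.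
transitivity ((geom L ^+ m * (1 - 'X^(s.+1)) ^+ m)`_s).
  by rewrite EQ mulrDr mulr1 coefD mulrA coefMXn ltnSn addr0.
rewrite E exprBn big_distrl /= coef_sum big_mkord.
have term i : ((-1) ^+ i * 1 ^+ (m - i) * 'X^L ^+ i *+ 'C(m, i) * geom s.+1 ^+ m)`_s =
   if (i * L <= s)%N then (-1) ^+ i * 'C(m, i)%:Z * 'C(m + s - i * L - 1, m - 1)%:Z else 0.
  rewrite expr1n mulr1 -exprM mulnC mulrnAl coefMn -mulrA [_ * geom _ ^+ _]mulrC mulrA coefMXn.
  rewrite ltnNge; case: leqP => //= le; last by rewrite mul0rn.
  have -> : (-1) ^+ i * geom s.+1 ^+ m = ((-1) ^+ i : int) *: geom s.+1 ^+ m.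
    by rewrite -mul_polyC rmorphXn rmorphN1.
  rewrite coefZ -[in geom _ ^+ m](prednK m_gt0) coef_geom_pow ?ltnS ?leq_subr //.
  rewrite -mulr_natr natz -!mulrA; congr (_ * _); rewrite mulrC; congr (_ * _%:Z).
  have -> : (m + s - i * L - 1 = m.-1 + (s - i * L))%N by lia.
  have B r : 'C(m.-1 + r, r) = 'C(m.-1 + r, m - 1) by rewrite -bin_sub ?leq_addl // addnK subn1.
  by rewrite B.
under eq_bigr => i _ do rewrite term.
pose G i := (-1) ^+ i * 'C(m, i)%:Z * 'C(m + s - i * L - 1, m - 1)%:Z : int.
have le_div i : (i * L <= s)%N = (i < (s %/ L).+1)%N by rewrite ltnS leq_divRL.
rewrite -big_mkcond /= -(big_mkord (fun i => i * L <= s)%N G) -(big_mkord xpredT G).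
pose N := maxn m.+1 (s %/ L).+1.
have H (P : pred nat) M : (M <= N)%N -> (forall i, (M <= i < N)%N -> P i -> G i = 0) ->
    \sum_(0 <= i < M | P i) G i = \sum_(0 <= i < N | P i) G i.
  move=> leMN G0; rewrite [RHS](big_cat_nat (n := M)) //= [X in _ + X]big_nat_cond.
  by rewrite [X in _ + X]big1 ?addr0 // => i /andP[/G0]; auto.
rewrite (H _ m.+1) ?leq_maxl //; last first.
  by move=> i /andP[lt _] _; rewrite /G bin_small ?mulr0 ?mul0r.
rewrite [RHS](big_nat_widen _ _ N) ?leq_maxr //.
by apply: eq_bigl => i; rewrite le_div.
Qed.

Lemma coef_binomial_poly n s : ((1 + 'X : {poly int}) ^+ n)`_s = 'C(n, s)%:Z.
Proof.
rewrite exprDn coef_sum; under eq_bigr => i _ do rewrite expr1n mul1r coefMn coefXn.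
have [le|gt] := leqP s n.
  rewrite (bigD1 (Ordinal (le : s < n.+1)%N)) //= eqxx big1 ?addr0 ?natz // => i ne.
  case: eqP => [E|_]; last by rewrite mul0rn.
  by case/eqP: ne; apply: val_inj.
rewrite bin_small // big1 // => i _; case: eqP => [E|_]; last by rewrite mul0rn.
by have := ltn_ord i; rewrite -E; lia.
Qed.

Definition bounded_count (L m s : nat) : nat :=
  #|[pred a : {ffun 'I_m -> 'I_L.+1} | \sum_i (a i : nat) == s]|.

Lemma degree_poly_geom (L : nat) : degree_poly (fun j : 'I_L => j : nat) = geom L.
Proof. by []. Qed.

Lemma bounded_countE L m s : (bounded_count L m s)%:Z = (geom L.+1 ^+ m)`_s.
Proof. by rewrite -degree_poly_geom -degree_poly_ffun coef_degree_poly. Qed.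

Lemma degree_poly_bool n :
  degree_poly (fun a : {ffun 'I_n -> bool} => \sum_i (a i : nat))%N = (1 + 'X) ^+ n.
Proof.
rewrite (degree_poly_ffun (fun b : bool => b : nat)) /degree_poly.
by rewrite big_bool /= expr0 expr1 addrC.
Qed.

Lemma occupation_count L m n t :
  #|[pred b : {ffun 'I_m -> 'I_L.+1} * {ffun 'I_n -> bool} |
      (\sum_i b.1 i + \sum_i b.2 i)%N == t]|
  = (\sum_(0 <= s < t.+1) 'C(n, s) * bounded_count L m (t - s))%N.
Proof.
apply/eqP; rewrite -eqz_nat; apply/eqP.
rewrite -(coef_degree_poly
  (fun b : {ffun 'I_m -> 'I_L.+1} * {ffun 'I_n -> bool} => \sum_i b.1 i + \sum_i b.2 i)%N).
rewrite (degree_poly_prod (fun a : {ffun 'I_m -> 'I_L.+1} => \sum_i a i)%N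
  (fun a : {ffun 'I_n -> bool} => \sum_i a i)%N).
rewrite degree_poly_bool mulrC coefM big_mkord -natz natr_sum; apply: eq_bigr => s _.
rewrite coef_binomial_poly natz PoszM bounded_countE -degree_poly_geom.
by rewrite (degree_poly_ffun (fun j : 'I_L.+1 => j : nat)).
Qed.

Lemma sum_binomial_truncate (f : nat -> nat) n t : (n < t)%N ->
  (\sum_(0 <= s < t.+1) 'C(n, s) * f s = \sum_(0 <= s < n.+1) 'C(n, s) * f s)%N.
Proof.
move=> lt; rewrite (big_cat_nat (n := n.+1)) //=; last lia.
rewrite [X in (_ + X)%N]big_nat_cond [X in (_ + X)%N]big1 ?addn0 // => s /andP[/andP[gt _] _].
by rewrite bin_small.
Qed.

Lemma bounded_count_binomial L m s : (0 < m)%N -> (s <= L)%N ->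
  bounded_count L m s = 'C(m + s - 1, s).
Proof.
move=> m_gt0 le; apply/eqP; rewrite -eqz_nat bounded_countE -[in geom _ ^+ m](prednK m_gt0).
rewrite coef_geom_pow //; apply/eqP; congr ('C(_, _))%:Z; lia.
Qed.

End Counting.

(** * The dimensions of the theorem *)

Section Dimensions.

Variables (k : fieldType) (m n t : nat).

Definition state_index l (b : occupation m n t l) : gr_index m n :=
  ([ffun i => b.1 i : nat], b.2).

Lemma state_index_inj l : injective (@state_index l).
Proof.
move=> [b1 b2] [c1 c2] [E <-]; congr (_, _); apply/ffunP => i; apply: val_inj.
by have /ffunP/(_ i) := E; rewrite !ffunE.
Qed.

Lemma state_index_degree l (b : occupation m n t l) :
  gr_degree (state_index b) = occ_degree b.
Proof. by congr (_ + _)%N; apply: eq_bigr => i _; rewrite ffunE. Qed.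

Lemma state_index_surj l (b : gr_index m n) : (forall i, (b.1 i < (cap t l).+1)%N) ->
  exists c : occupation m n t l, state_index c = b.
Proof.
case: b => b1 b2 /= lt; exists ([ffun i => Ordinal (lt i)], b2).
by congr (_, _); apply/ffunP => i; rewrite !ffunE.
Qed.

Lemma card_state l : #|{: state m n t l}| =
  #|[pred b : occupation m n t l | occ_degree b == t]|.
Proof. exact: card_sig. Qed.

Lemma Omega_dim : has_dim (@Omega_deg k m n t) #|{: state m n t 0}|.
Proof.
rewrite card_state; apply: (has_dim_free_span (@state_index_inj 0)) => w; split.
  move=> [b [deg_b ->]]; have [i|c Ec] := @state_index_surj 0 b.
    by rewrite /cap /= ltnS -deg_b /gr_degree (bigD1 i) //=; lia.
  by exists c; rewrite ?inE -?state_index_degree Ec ?deg_b.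
move=> [c Pc ->]; exists (state_index c); split=> //.
by rewrite state_index_degree; apply/eqP.
Qed.

Lemma Omega1_dim l : (2 < l)%N -> has_dim (@Omega1_deg k l m n t) #|{: state m n t l}|.
Proof.
move=> l_gt2; have capE : cap t l = l.-1 by rewrite /cap; case: eqP => //; lia.
rewrite card_state; apply: (has_dim_free_span (@state_index_inj l)) => w; split.
  move=> [b [le_b deg_b ->]]; have [i|c Ec] := @state_index_surj l b.
    by rewrite capE ltnS.
  by exists c; rewrite ?inE -?state_index_degree Ec ?deg_b.
move=> [c Pc ->]; exists (state_index c); split=> //.
  by move=> i; rewrite ffunE -ltnS -capE.
by rewrite state_index_degree; apply/eqP.
Qed.

Lemma A1_dim l s : (2 < l)%N -> has_dim (@A1_deg k l m s) (bounded_count l.-1 m s).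
Proof.
move=> l_gt2; pose g (a : {ffun 'I_m -> 'I_l.-1.+1}) : {ffun 'I_m -> nat} := [ffun i => a i : nat].
have g_inj : injective g.
  move=> a c /ffunP E; apply/ffunP => i; apply: val_inj.
  by have := E i; rewrite !ffunE.
have g_sum a : (\sum_i g a i = \sum_i a i)%N by apply: eq_bigr => i _; rewrite ffunE.
apply: (has_dim_free_span g_inj) => w; split.
  move=> [a [le_a <- ->]]; exists [ffun i => inord (a i)].
    by rewrite inE; apply/eqP/eq_bigr => i _; rewrite ffunE inordK // ltnS.
  by congr << _ >>; apply/ffunP => i; rewrite !ffunE inordK // ltnS.
move=> [a /eqP sum_a ->]; exists (g a); rewrite g_sum; split=> // i.
by rewrite ffunE -ltnS.
Qed.

Lemma card_state_sum l : #|{: state m n t l}| =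
  (\sum_(0 <= s < t.+1) 'C(n, s) * bounded_count (cap t l) m (t - s))%N.
Proof. by rewrite card_state -occupation_count. Qed.

Lemma card_state_generic : (0 < m)%N -> #|{: state m n t 0}| =
  (\sum_(0 <= s < t.+1) 'C(m + t - s - 1, t - s) * 'C(n, s))%N.
Proof.
move=> m_gt0; rewrite card_state_sum; apply: eq_big_nat => s Hs.
rewrite bounded_count_binomial ?leq_subr // mulnC; congr ('C(_, _) * _)%N; lia.
Qed.

End Dimensions.

Section Modules.

Variables (k : fieldType) (q : k) (m n t : nat).
Hypotheses (q_neq0 : q != 0) (q2_neq1 : q ^+ 2 != 1) (two_neq0 : (2%:R : k) != 0).
Hypothesis m_gt0 : (0 < m)%N.

(** The state with t units at position 1 is greedy.  The level of a word is its
    number of letters F_m. *)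
Lemma Vlam_generic_dim X : qchar_is q 0 ->
  dim_Vlam_is X q m n (wscale t%:Z (omega 1)) #|{: state m n t 0}|.
Proof.
move=> q_generic; set lam := wscale _ _.
have lamE x : lam x = if x == 1%N then t%:Z else 0.
  by rewrite /lam /wscale /omega; case: x => [|[|x]] //=; rewrite ?mulr1 ?mulr0.
have [||j Jj|top top_greedy top_lam] :=
  @greedy_state k q m n t 0 q_neq0 q2_neq1 (or_introl erefl) lam.
- move=> x Nx; rewrite lamE /admissible; case: eqP => [->|_]; first by rewrite m_gt0.
  by case: ifP.
- rewrite (bigD1_seq 1%N) ?iota_uniq ?mem_index_iota //=; last lia.
  by rewrite lamE eqxx big1 ?addr0 // => x /negPf ne; rewrite lamE ne.
- by rewrite !lamE; case: j Jj => [|j] // _; rewrite eqxx.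
have l0 : 0%N = 0%N \/ (2 < 0)%N by left.
split; first by eexists; eexists; exact: (fock_is_Vlam q_neq0 q2_neq1 q_generic l0 X top_greedy top_lam).
move=> V A [modA simA [v [hwv _]]].
have modF := fock_is_module m n t q_neq0 q2_neq1 q_generic l0 X.
apply: (highest_weight_unique (lev := count_mem m) q_neq0 two_neq0 _ _ modF
  (fock_is_simple q_neq0 q2_neq1 q_generic l0 X top_greedy)
  (fock_highest q_neq0 q2_neq1 l0 X top_greedy top_lam) _ modA simA hwv).
- by move=> s1 s2; rewrite count_cat.
- move=> s; exact: generic_trivial_word.
- exact: generic_lev_nilpotent modF.
- exact: generic_lev_nilpotent modA.
- exact: fock_has_dim.
Qed.

(** The state with positions 1, ..., i - 1 full and ti units at position i is
    greedy.  The level of a word is its length. *)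
Lemma Vlam_restricted_dim X l i ti : (2 < l)%N -> qchar_is q l ->
  (1 <= i <= m)%N -> (ti <= l - 1)%N -> t = ((i - 1) * (l - 1) + ti)%N ->
  dim_Vlam_restricted_is X q m n l
    (wadd (wscale (l - 1 - ti)%N%:Z (omega (i - 1))) (wscale ti%:Z (omega i)))
    #|{: state m n t l}|.
Proof.
move=> l_gt2 q_l Hi le_ti Et; set lam := wadd _ _.
have lamE x : (0 < x)%N -> lam x =
    if (x < i)%N then (l - 1)%N%:Z else if x == i then ti%:Z else 0.
  rewrite /lam /wadd /wscale /omega => -> /=.
  have -> : (x <= i - 1)%N = (x < i)%N by lia.
  by case: ltngtP => _; rewrite ?mulr1 ?mulr0 ?addr0 ?add0r // -PoszD subnK.
have l2 : l = 0%N \/ (2 < l)%N by right.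
have l_neq0 : (l == 0%N) = false by lia.
have [||j Jj|top top_greedy top_lam] := @greedy_state k q m n t l q_neq0 q2_neq1 l2 lam.
- move=> x /andP[x_gt0 _]; rewrite lamE // /admissible l_neq0.
  by do 2![case: ifP]; do ?case: ifP; lia.
- rewrite (big_cat_nat (n := i)) /=; [|lia|lia].
  rewrite [X in _ + X]big_ltn; last lia.
  rewrite lamE ?ltnn ?eqxx; last lia.
  rewrite [X in _ + (_ + X)]big_nat_cond [X in _ + (_ + X)]big1 ?addr0; last first.
    by move=> x Hx; rewrite lamE; [do 2?case: ifP; lia|lia].
  transitivity (\sum_(1 <= x < i) (l - 1)%N%:Z + ti%:Z).
    by congr (_ + _); apply: eq_big_nat => x Hx; rewrite lamE; [case: ifP; lia|lia].
  by rewrite sumr_const_nat Et PoszD PoszM mulrC -mulr_natr natz.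
- have j_gt0 : (0 < j)%N by move: Jj; rewrite /inJ; lia.
  rewrite !lamE // /admissible l_neq0.
  by do ?case: ifP; lia.
split; first by eexists; eexists; exact: (fock_is_Vlam_restricted q_neq0 q2_neq1 q_l l2 X top_greedy top_lam l_gt2).
move=> V A [modA _ simA [v [hwv _ nilv]]].
have nil (W : lmodType k) (B : action W) w :
    F_nilpotent m n B w -> lev_nilpotent m n size B w by [].
apply: (highest_weight_unique (lev := size) q_neq0 two_neq0 _ _
  (fock_is_module m n t q_neq0 q2_neq1 q_l l2 X)
  (fock_is_simple q_neq0 q2_neq1 q_l l2 X top_greedy)
  (fock_highest q_neq0 q2_neq1 l2 X top_greedy top_lam) _ modA simA hwv).
- by move=> s1 s2; rewrite size_cat.
- by move=> s _ ? _; rewrite lt0n size_eq0.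
- by apply: nil; apply: fock_F_nilpotent top_greedy _.
- exact: nil.
- exact: fock_has_dim.
Qed.

End Modules.

Theorem corollary29 (k : closedFieldType) (chark : [pchar k] =i pred0)
    (q : k) (q_neq0 : q != 0) (q2_neq1 : q ^+ 2 != 1)
    (m n t : nat) (m_ge1 : (1 <= m)%N) :
  (qchar_is q 0 ->
    ((t <= n)%N ->
      has_dim (@Omega_deg k m n t)
        (\sum_(0 <= s < t.+1) 'C(m + t - s - 1, t - s) * 'C(n, s))%N /\
      forall X : version,
        dim_Vlam_is X q m n (wscale t%:Z (omega 1))
          (\sum_(0 <= s < t.+1) 'C(m + t - s - 1, t - s) * 'C(n, s))%N) /\
    ((n < t)%N ->
      has_dim (@Omega_deg k m n t)
        (\sum_(0 <= s < n.+1) 'C(m + t - s - 1, t - s) * 'C(n, s))%N /\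
      forall X : version,
        dim_Vlam_is X q m n (wscale t%:Z (omega 1))
          (\sum_(0 <= s < n.+1) 'C(m + t - s - 1, t - s) * 'C(n, s))%N)) /\
  (forall l : nat, (2 < l)%N -> qchar_is q l ->
    (exists dimA : nat -> nat,
      (forall s, has_dim (@A1_deg k l m s) (dimA s)) /\
      (forall s, (dimA s)%:Z =
        \sum_(0 <= i < (s %/ l).+1)
          (-1) ^+ i * ('C(m, i))%:Z * ('C(m + s - i * l - 1, m - 1))%:Z) /\
      ((t <= n)%N ->
        has_dim (@Omega1_deg k l m n t)
          (\sum_(0 <= s < t.+1) 'C(n, s) * dimA (t - s))%N) /\
      ((n < t)%N ->
        has_dim (@Omega1_deg k l m n t)
          (\sum_(0 <= s < n.+1) 'C(n, s) * dimA (t - s))%N)) /\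
    (forall i ti : nat, (1 <= i <= m)%N -> (ti <= l - 1)%N ->
      t = ((i - 1) * (l - 1) + ti)%N ->
      forall d : nat, has_dim (@Omega1_deg k l m n t) d ->
      forall X : version,
        dim_Vlam_restricted_is X q m n l
          (wadd (wscale (l - 1 - ti)%N%:Z (omega (i - 1)))
                (wscale ti%:Z (omega i))) d)).
Proof.
have two_neq0 : (2%:R : k) != 0.
  by apply/negP => E; have := chark 2%N; rewrite inE /= E.
split=> [q_generic|l l_gt2 q_l].
  have E := card_state_generic n t m_ge1.
  split=> [_|lt_nt]; first by rewrite -E; split=> [|X]; [exact: Omega_dim|exact: Vlam_generic_dim].
  have E' : (\sum_(0 <= s < n.+1) 'C(m + t - s - 1, t - s) * 'C(n, s))%N = #|{: state m n t 0}|.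
    rewrite E; pose f s := 'C(m + t - s - 1, t - s).
    transitivity (\sum_(0 <= s < n.+1) 'C(n, s) * f s)%N; first by apply: eq_bigr => s _; rewrite mulnC.
    by rewrite -(sum_binomial_truncate f lt_nt); apply: eq_bigr => s _; rewrite mulnC.
  by rewrite E'; split=> [|X]; [exact: Omega_dim|exact: Vlam_generic_dim].
have capE : cap t l = l.-1 by rewrite /cap; case: eqP => //; lia.
split=> [|i ti Hi le_ti Et d dim_d X].
  exists (bounded_count l.-1 m); split; first by move=> s; apply: A1_dim.
  split; first by move=> s; rewrite bounded_countE prednK ?coef_truncated //; lia.
  have E : #|{: state m n t l}| =
      (\sum_(0 <= s < t.+1) 'C(n, s) * bounded_count l.-1 m (t - s))%N.
    by rewrite card_state_sum capE.
  split=> [_|lt_nt]; first by rewrite -E; apply: Omega1_dim.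
  by rewrite -(sum_binomial_truncate _ lt_nt) -E; apply: Omega1_dim.
rewrite (has_dim_unique dim_d (Omega1_dim k m n t l_gt2)).
exact: Vlam_restricted_dim.
Qed.
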